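(* Assume: (A1) $Y\subseteq\mathbb{R}^n$ is closed and convex, $S=X\cap Y$ is nonempty, and $g_a:\mathbb{R}^n\to\mathbb{R}$ is convex for every $a\in\mathcal{A}$. (A2) $Y$ is bounded, with $\max_{x,y\in Y}\|x-y\|^2\le D$. (A5) There is $c>0$ with $\mathrm{dist}^2(x,S)\le c\,\mathsf{E}[(g^+_{\omega_k^i}(x))^2]$ for all $x\in Y$, $i=1,\dots,N_k$, $k\ge1$. Let $q=\frac{\beta(2-\beta)}{cM_g^2}$ with $0<\beta<2$, where $q\in(0,1)$. Then for every $k\ge1$ the output $x_k$ of the random feasibility steps started at $v_k$ satisfies, almost surely, $$\mathsf{E}[\mathrm{dist}^2(x_k,S)\mid\mathcal{F}_{k-1}]\le(1-q)^{N_k}\|v_k-x\|^2\quad\text{for all }x\in S,$$ $$\mathsf{E}[\mathrm{dist}(x_k,S)\mid\mathcal{F}_{k-1}]\le(1-q)^{N_k/2}\|v_k-x\|\quad\text{for all }x\in S.$$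
   Context: Problem data: $Y\subseteq\mathbb{R}^n$, an index set $\mathcal{A}$ (possibly infinite), functions $g_a:\mathbb{R}^n\to\mathbb{R}$, $X=\bigcap_{a\in\mathcal{A}}\{x\in\mathbb{R}^n: g_a(x)\le0\}$, $S=X\cap Y$. $g_a^+(x)=\max\{g_a(x),0\}$; $\|\cdot\|$ is the Euclidean norm; $\Pi_C$ is the Euclidean projection onto a closed convex set $C$ and $\mathrm{dist}(x,C)$ the Euclidean distance. $M_g>0$ is such that $\|d\|\le M_g$ for all $d\in\partial g_a(x)$, $x\in Y$, $a\in\mathcal{A}$. The point $v_k$ is produced by the modified stochastic Korpelevich method: start at a random $x_0\in Y$, deterministic step sizes $\alpha_k>0$; for $k=1,2,\dots$: sample $\xi_k^1\in\Xi$, $u_k=\Pi_Y[x_{k-1}-\alpha_{k-1}\widehat F(x_{k-1},\xi_k^1)]$; sample $\xi_k^2\in\Xi$, $v_k=\Pi_Y[x_{k-1}-\alpha_{k-1}\widehat F(u_k,\xi_k^2)]$, where $\widehat F:Y\times\Xi\to\mathbb{R}^n$ is a stochastic oracle; then obtain $x_k$ from $v_k$ by random feasibility steps. Random feasibility steps (input $v_k\in Y$, deterministic $N_k\ge1$, $\beta\in(0,2)$): $z_k^0=v_k$; for $i=1,\dots,N_k$ choose a random index $\omega_k^i\in\mathcal{A}$, take $d_k^i\in\partial g^+_{\omega_k^i}(z_k^{i-1})$ if $g^+_{\omega_k^i}(z_k^{i-1})>0$ and $d_k^i=d$ for some fixed $d\ne0$ otherwise, and set $z_k^i=\Pi_Y\left[z_k^{i-1}-\beta\frac{g^+_{\omega_k^i}(z_k^{i-1})}{\|d_k^i\|^2}d_k^i\right]$;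 output $x_k=z_k^{N_k}$. $\mathcal{F}_{k-1}$ ($k\ge1$) is the sigma-algebra generated by $x_0$, $\{\omega_t^i:1\le i\le N_t,\ 1\le t\le k-1\}$ and $\{\xi_t^1,\xi_t^2:1\le t\le k\}$; in particular $v_k$ is $\mathcal{F}_{k-1}$-measurable. Sampling convention: in (A5) the expectation is over the draw of $\omega_k^i$, which may be i.i.d. sampling or sampling with a distribution conditional on the past; in the latter case the inequality in (A5) is understood to hold a.s. with the expectation conditional on $\mathcal{F}_{k-1}$ and $\omega_k^1,\dots,\omega_k^{i-1}$. *)

(* Defs.v *)
From HB Require Import structures.
From mathcomp Require Import all_boot all_order all_algebra.
From mathcomp Require Import all_classical all_reals all_analysis.
From mathcomp Require Import measurable_realfun.

Set Implicit Arguments.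
Unset Strict Implicit.
Unset Printing Implicit Defensive.

Import Order.TTheory GRing.Theory Num.Theory.
Import numFieldNormedType.Exports.

Local Open Scope classical_set_scope.
Local Open Scope ring_scope.

Section euclidean_space.
Context {R : realType} {n : nat}.
Implicit Types (x y p d : 'rV[R]_n) (C : set 'rV[R]_n) (f : 'rV[R]_n -> R).

Definition eucl_dot x y : R := \sum_(j < n) x 0 j * y 0 j.

(* The norm [`|x|] of the library on row vectors is the sup norm; it induces
   the same topology as [eucl_norm], hence the same closed and Borel sets. *)
Definition eucl_norm x : R := Num.sqrt (eucl_dot x x).

Definition eucl_dist x C : R := inf [set eucl_norm (x - y) | y in C].

(* The nearest point of [C] to [x]; it exists and is unique when [C] is
   nonempty, closed and convex. *)
Definition eucl_proj C x : 'rV[R]_n :=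
  get [set p | C p /\ forall y, C y -> eucl_norm (x - p) <= eucl_norm (x - y)].

Definition subdiff f x : set 'rV[R]_n :=
  [set d | forall y, f x + eucl_dot d (y - x) <= f y].

Definition pospart f : 'rV[R]_n -> R := fun x => Num.max (f x) 0.

End euclidean_space.

Definition feasible_set {R : realType} {n : nat} {A : Type}
    (g : A -> 'rV[R]_n -> R) : set 'rV[R]_n :=
  \bigcap_(a in [set: A]) [set x | g a x <= 0].

(* R^n with its Borel sigma-algebra. *)
Definition borel_rV (R : realType) (n : nat) :=
  g_sigma_algebraType (@open 'rV[R]_n).

Section conditional_expectation.
Context {d : measure_display} {T : measurableType d}.

(* Measurability with respect to the sigma-algebra generated by [G]. *)
Definition measurable_wrt (G : set (set T)) {d' : measure_display}
    {T' : measurableType d'} (f : T -> T') : Prop :=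
  measurable_fun [set: g_sigma_algebraType G] (f : g_sigma_algebraType G -> T').

Context {R : realType} (P : probability T R).

Definition is_cond_exp (G : set (set T)) (X Z : T -> R) : Prop :=
  [/\ measurable_wrt G Z,
      P.-integrable [set: T] (EFin \o Z) &
      forall B, <<s G >> B ->
        (\int[P]_(w in B) (Z w)%:E = \int[P]_(w in B) (X w)%:E)%E].

(* A version of E[X | sigma(G)]; see [cond_expP] for its existence. *)
Definition cond_exp (G : set (set T)) (X : T -> R) : T -> R :=
  get [set Z | is_cond_exp G X Z].

Lemma cond_expP (G : set (set T)) (X : T -> R) :
  G `<=` measurable -> P.-integrable [set: T] (EFin \o X) ->
  is_cond_exp G X (cond_exp G X).
Proof.
move=> Gm iX; apply: getPex.
have sGm : <<s G >> `<=` @measurable _ T.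
  by apply: smallest_sub => //; exact: sigma_algebra_measurable.
pose phi : T -> g_sigma_algebraType G := id.
have mphi : measurable_fun setT phi.
  by move=> _ B mB; rewrite setTI; exact: sGm.
pose phiM := MeasurableFun.Pack (MeasurableFun.Class
  (isMeasurableFun.Build _ _ _ _ phi mphi)).
pose Q : probability (g_sigma_algebraType G) R := distribution P phiM.
pose nu := measure_function_pushforward__canonical__charge_Charge (induced_charge iX) mphi.
have nuQ : nu `<< Q.
  apply: dominates_pushforward => //; apply/null_content_dominatesP => B mB PB0.
  apply: null_set_integral => //.
  apply: (measurable_funS measurableT) => //; exact: measurable_int iX.
pose f : g_sigma_algebraType G -> \bar R := Radon_Nikodym nu Q.
have ffin w : f w \is a fin_num by exact: Radon_Nikodym_fin_num.
have fE : EFin \o (fine \o f) = f by apply/funext => w /=; rewrite fineK.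
have mf : measurable_fun setT f.
  by apply: measurable_int (Radon_Nikodym_integrable nuQ).
have if_ : P.-integrable setT (f \o phi).
  apply/integrableP; split; first exact: (measurableT_comp mf mphi).
  have /integrableP[_] := Radon_Nikodym_integrable nuQ.
  rewrite ge0_integral_pushforward//.
  exact: measurableT_comp.
exists (fine \o f); split.
- exact: measurableT_comp.
- by rewrite fE.
- move=> B GB.
  transitivity (\int[P]_(w in B) (f \o phi) w)%E.
    by apply: eq_integral => w _; rewrite /= fineK.
  rewrite -[LHS](@integral_pushforward _ _ _ _ _ phi mphi P B f mf)//.
    exact: (esym (Radon_Nikodym_integral nuQ _)).
  by apply: (integrableS measurableT) => //; exact: sGm.
Qed.

Definition sigma_of {d' : measure_display} {T' : measurableType d'}
    (f : T -> T') : set (set T) :=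
  preimage_set_system [set: T] f measurable.

Definition independent_of (G : set (set T)) {d' : measure_display}
    {T' : measurableType d'} (f : T -> T') : Prop :=
  forall B U, G B -> measurable U ->
    P (B `&` f @^-1` U) = (P B * P (f @^-1` U))%E.

End conditional_expectation.

Section method.
Context {R : realType} {n : nat} {d dA dXi : measure_display}
  {T : measurableType d} {A : measurableType dA} {Xi : measurableType dXi}.
Variables (x0 : T -> 'rV[R]_n) (xi1 xi2 : nat -> T -> Xi)
  (omega : nat -> nat -> T -> A) (N : nat -> nat).

(* [filtration k] is F_k, so that the F_{k-1} of iteration k is
   [filtration k.-1]: it contains the oracle samples of iteration k. *)
Definition filtration (k : nat) : set (set T) :=
  <<s sigma_of (x0 : T -> borel_rV R n) `|`
      \bigcup_(t in [set t | (1 <= t <= k.+1)%N])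
         (sigma_of (xi1 t) `|` sigma_of (xi2 t)) `|`
      \bigcup_(t in [set t | (1 <= t <= k)%N])
         \bigcup_(i in [set i | (1 <= i <= N t)%N]) sigma_of (omega t i) >>.

(* F_{k-1} enlarged with omega_k^1, ..., omega_k^i. *)
Definition inner_filtration (k i : nat) : set (set T) :=
  <<s filtration k.-1 `|`
      \bigcup_(j in [set j | (1 <= j <= i)%N]) sigma_of (omega k j) >>.

(* Each index is drawn independently of everything that precedes it, always
   with the same law. *)
Definition iid_sampling (P : probability T R) : Prop :=
  (forall k i, (1 <= k)%N -> (1 <= i <= N k)%N ->
     independent_of P (inner_filtration k i.-1) (omega k i)) /\
  (forall k i k' i', (1 <= k)%N -> (1 <= i <= N k)%N ->
     (1 <= k')%N -> (1 <= i' <= N k')%N ->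
     forall U, measurable U -> P (omega k i @^-1` U) = P (omega k' i' @^-1` U)).

(* One run of the feasibility steps from [v]: indices [om i], directions [dd i]
   and iterates [z i], for [1 <= i <= M]. *)
Definition feasibility_steps (Y : set 'rV[R]_n) (g : A -> 'rV[R]_n -> R)
    (beta : R) (d0 : 'rV[R]_n) (M : nat) (v : 'rV[R]_n) (om : nat -> A)
    (dd z : nat -> 'rV[R]_n) : Prop :=
  z 0%N = v /\
  forall i, (1 <= i <= M)%N ->
    let gp := pospart (g (om i)) in
    [/\ 0 < gp (z i.-1) -> subdiff gp (z i.-1) (dd i),
        ~ 0 < gp (z i.-1) -> dd i = d0 &
        z i = eucl_proj Y
          (z i.-1 - (beta * (gp (z i.-1) / eucl_norm (dd i) ^+ 2)) *: dd i)].

(* Unconditional expectation for i.i.d. sampling; otherwise the law of omega_k^i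
   may depend on the past and the inequality holds a.s., for each [x], with the
   expectation conditional on that past. *)
Definition growth_condition (P : probability T R) (Y : set 'rV[R]_n)
    (g : A -> 'rV[R]_n -> R) (c : R) : Prop :=
  let S := feasible_set g `&` Y in
  (iid_sampling P /\
   forall k i x, (1 <= k)%N -> (1 <= i <= N k)%N -> Y x ->
     ((eucl_dist x S ^+ 2)%:E <=
      c%:E * 'E_P[(fun w => pospart (g (omega k i w)) x ^+ 2)%R])%E)
  \/
  (forall k i x, (1 <= k)%N -> (1 <= i <= N k)%N -> Y x ->
     {ae P, forall w, eucl_dist x S ^+ 2 <=
        c * cond_exp P (inner_filtration k i.-1)
              (fun w' => pospart (g (omega k i w')) x ^+ 2) w}).

End method.

(* Main.v *)
(* For [s] in S, projection onto Y and the subgradient inequality give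
     |z_i - s|^2 <= |z_(i-1) - s|^2
                    - beta (2 - beta) / Mg^2 * g_(omega_i)^+(z_(i-1))^2,
   and taking the infimum over [s] turns this into a descent of dist^2(., S).
   Integrating over an event [B] of the past and using (A5) at the random point
   z_(i-1) contracts the integral of dist^2 over [B] by the factor 1 - q; after
   N_k steps this characterizes the conditional expectation bound.

   (A5) only speaks of deterministic points. It transfers to z_(i-1) by
   partitioning Y into countably many small cells, because every finite convex
   function has subgradients, so that all the g_a^+ are Mg-Lipschitz on Y. The
   same Lipschitz bound gives the joint measurability of (a, x) |-> g_a^+(x) and
   the integrability of g_a^+(x)^2. *)
Require Import Defs.
From HB Require Import structures.
From mathcomp Require Import all_boot all_order all_algebra.
From mathcomp Require Import all_classical all_reals all_analysis.
From mathcomp Require Import measurable_realfun ring lra.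

Set Implicit Arguments.
Unset Strict Implicit.
Unset Printing Implicit Defensive.

Import Order.TTheory GRing.Theory Num.Theory.
Import numFieldNormedType.Exports.

Local Open Scope classical_set_scope.
Local Open Scope ring_scope.

(** * Euclidean projection and distance *)

Section euclidean_space.
Context {R : realType} {n : nat}.
Implicit Types (x y z p d : 'rV[R]_n) (C : set 'rV[R]_n).

(** In its conditional form (A5) comes with an exceptional null set that depends on the point, and
    there are uncountably many points, so it cannot simply be evaluated at a random iterate.
    Integrated over an event of the past, the i.i.d. and the conditional form become one and the
    same inequality between integrals, with no null set left; this form can be summed over cells on
    which the iterate is nearly constant. Conditional expectations enter again only at the end,
    where the bounds on integrals over all events of F_{k-1} are turned into almost sure bounds.
    There the comparison is with dist(v_k, S), which does not involve the point of S, so that a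
    single null set serves all of S. *)

Lemma eucl_dotC x y : eucl_dot x y = eucl_dot y x.
Proof. by apply: eq_bigr => j _; rewrite mulrC. Qed.

Lemma eucl_dotDl x y z : eucl_dot (x + y) z = eucl_dot x z + eucl_dot y z.
Proof. by rewrite -big_split; apply: eq_bigr => j _; rewrite mxE mulrDl. Qed.

Lemma eucl_dotZl (t : R) x y : eucl_dot (t *: x) y = t * eucl_dot x y.
Proof. by rewrite mulr_sumr; apply: eq_bigr => j _; rewrite mxE mulrA. Qed.

Lemma eucl_dotDr x y z : eucl_dot z (x + y) = eucl_dot z x + eucl_dot z y.
Proof. by rewrite eucl_dotC eucl_dotDl !(eucl_dotC z). Qed.

Lemma eucl_dotZr (t : R) x y : eucl_dot x (t *: y) = t * eucl_dot x y.
Proof. by rewrite eucl_dotC eucl_dotZl eucl_dotC. Qed.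

Lemma eucl_dotNl x y : eucl_dot (- x) y = - eucl_dot x y.
Proof. by rewrite -scaleN1r eucl_dotZl mulN1r. Qed.

Lemma eucl_dotNr x y : eucl_dot x (- y) = - eucl_dot x y.
Proof. by rewrite eucl_dotC eucl_dotNl eucl_dotC. Qed.

Definition eucl_dotE :=
  (eucl_dotDl, eucl_dotDr, eucl_dotNl, eucl_dotNr, eucl_dotZl, eucl_dotZr).

Lemma eucl_dot0r x : eucl_dot x 0 = 0.
Proof. by rewrite -(scale0r 0) eucl_dotZr mul0r. Qed.

Lemma eucl_dot_sqrB x y :
  eucl_dot (x - y) (x - y) = eucl_dot x x - 2 * eucl_dot x y + eucl_dot y y.
Proof. by rewrite !eucl_dotE (eucl_dotC y x); ring. Qed.

Lemma eucl_dot_ge0 x : 0 <= eucl_dot x x.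
Proof. by apply: sumr_ge0 => j _; rewrite -expr2 sqr_ge0. Qed.

Lemma eucl_norm_ge0 x : 0 <= eucl_norm x.
Proof. exact: sqrtr_ge0. Qed.

Lemma sqr_eucl_norm x : eucl_norm x ^+ 2 = eucl_dot x x.
Proof. by rewrite sqr_sqrtr// eucl_dot_ge0. Qed.

Lemma eucl_norm0 : eucl_norm (0 : 'rV[R]_n) = 0.
Proof. by rewrite /eucl_norm eucl_dot0r sqrtr0. Qed.

Lemma eucl_normN x : eucl_norm (- x) = eucl_norm x.
Proof. by rewrite /eucl_norm !eucl_dotE opprK. Qed.

Lemma eucl_distrC x y : eucl_norm (x - y) = eucl_norm (y - x).
Proof. by rewrite -eucl_normN opprB. Qed.

Lemma eucl_norm_sqr_le x y :
  (eucl_norm x <= eucl_norm y) = (eucl_dot x x <= eucl_dot y y).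
Proof. by rewrite ler_sqrt// eucl_dot_ge0. Qed.

Lemma coord_le_eucl_norm x j : `|x 0 j| <= eucl_norm x.
Proof.
rewrite -sqrtr_sqr; apply: ler_wsqrtr.
by rewrite /eucl_dot (bigD1 j)//= -expr2 lerDl sumr_ge0// => i _;
  rewrite -expr2 sqr_ge0.
Qed.

Lemma eucl_norm_eq0 x : eucl_norm x = 0 -> x = 0.
Proof.
move=> x0; apply/rowP => j; rewrite mxE; apply/eqP.
by rewrite -normr_le0 -x0; exact: coord_le_eucl_norm.
Qed.

Lemma eucl_cauchy_schwarz x y : eucl_dot x y <= eucl_norm x * eucl_norm y.
Proof.
have [->|x0] := eqVneq x 0; first by rewrite eucl_dotC eucl_dot0r eucl_norm0 mul0r.
have [->|y0] := eqVneq y 0; first by rewrite eucl_dot0r eucl_norm0 mulr0.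
have pos z : z != 0 -> 0 < eucl_norm z.
  move=> z0; rewrite lt_neqAle eucl_norm_ge0 andbT eq_sym.
  by apply: contra z0 => /eqP/eucl_norm_eq0 ->.
(* With [a], [b] the norms and [t] the product, this square is [2 * a * b * (a * b - t)]. *)
have := eucl_dot_ge0 (eucl_norm y *: x - eucl_norm x *: y).
rewrite !eucl_dotE -!sqr_eucl_norm (eucl_dotC y x).
have := pos _ x0; have := pos _ y0.
set a := eucl_norm x; set b := eucl_norm y; set t := eucl_dot x y => b0 a0 h.
have : 0 <= (2 * (a * b)) * (a * b - t) by nra.
by rewrite pmulr_rge0 ?subr_ge0 ?mulr_gt0.
Qed.

Lemma ler_eucl_normD x y : eucl_norm (x + y) <= eucl_norm x + eucl_norm y.
Proof.
rewrite -ler_sqr ?nnegrE ?addr_ge0 ?eucl_norm_ge0// sqr_eucl_norm !eucl_dotE.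
rewrite sqrrD !sqr_eucl_norm (eucl_dotC y x).
by have := eucl_cauchy_schwarz x y; lra.
Qed.

Lemma ler_eucl_dist_add y x z :
  eucl_norm (x - z) <= eucl_norm (x - y) + eucl_norm (y - z).
Proof. by rewrite (le_trans _ (ler_eucl_normD _ _))// addrA subrK. Qed.

Lemma mx_norm_le_eucl_norm x : `|x| <= eucl_norm x.
Proof.
rewrite [leLHS]/Num.norm/= mx_normrE; apply/bigmax_leP; split => [|[i j] _] /=.
  exact: eucl_norm_ge0.
by rewrite ord1; exact: coord_le_eucl_norm.
Qed.

Lemma eucl_norm_le_mx_norm x : eucl_norm x <= n%:R * `|x|.
Proof.
have nx0 : 0 <= n%:R * `|x| by rewrite mulr_ge0.
rewrite -ler_sqr ?nnegrE ?eucl_norm_ge0// sqr_eucl_norm exprMn.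
apply: (@le_trans _ _ (n%:R * `|x| ^+ 2)).
  rewrite mulr_natl -[X in _ *+ X]card_ord -sumr_const; apply: ler_sum => j _.
  rewrite -expr2 -real_normK ?num_real// lerXn2r ?nnegrE//.
  rewrite [leRHS]/Num.norm/= mx_normrE.
  exact: (le_bigmax _ (fun ij : 'I_1 * 'I_n => `|x ij.1 ij.2|) (0, j)).
rewrite ler_wpM2r ?sqr_ge0// -natrX ler_nat.
by case: n => // m; rewrite expnS leq_pmulr.
Qed.

(** Moves Lipschitz bounds in the Euclidean norm to the topology of the library, which comes from
    the sup norm. *)
Lemma eucl_lipschitz_continuous (V : normedModType R) (f : 'rV[R]_n -> V) (K : R) :
  (forall x y, `|f x - f y| <= K * eucl_norm (x - y)) -> continuous f.
Proof.
move=> fK x A /nbhs_normP[e /= e0 eA].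
(* [K] may be negative and [n] zero; the absolute value and the [+ 1] keep [L] positive. *)
pose L := `|K| * n%:R + 1.
have L0 : 0 < L by rewrite ltr_wpDl// mulr_ge0.
apply/(@nbhs_normP _ 'rV[R]_n); exists (e / L); rewrite /= ?divr_gt0// => y /= xy.
apply/eA/(le_lt_trans (fK x y)).
apply: (@le_lt_trans _ _ (L * `|x - y|)); last by rewrite mulrC -ltr_pdivlMr.
apply: (@le_trans _ _ (`|K| * (n%:R * `|x - y|))).
  by rewrite (le_trans (ler_norm _))// normrM ler_pM// ger0_norm ?eucl_norm_ge0//
    eucl_norm_le_mx_norm.
by rewrite mulrA ler_wpM2r// lerDl.
Qed.

Lemma eucl_distr_continuous x : continuous (fun y => eucl_norm (x - y)).
Proof.
apply: (@eucl_lipschitz_continuous R^o _ 1) => y z; rewrite mul1r ler_norml.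
have := ler_eucl_dist_add y x z; have := ler_eucl_dist_add z x y.
by rewrite (eucl_distrC z y); lra.
Qed.

Lemma convex_setE (C : set (convex_lmodType 'rV[R]_n)) x y (t : R) :
  convex_set C -> 0 <= t <= 1 -> C x -> C y -> C (t *: x + (1 - t) *: y).
Proof.
move=> cC /andP[t0 t1] Cx Cy.
have /set_mem := cC x y (Itv01 t0 t1) (mem_set Cx) (mem_set Cy).
by [].
Qed.

(** * Projection onto a compact convex set *)

Section projection.
Variable C : set 'rV[R]_n.
Hypotheses (C0 : C !=set0) (Cc : compact C).

(** The extreme value theorem on the compact [C] provides a minimizer, so that [get] in [eucl_proj]
    really selects one. *)
Lemma eucl_projP x :
  C (eucl_proj C x) /\
  forall y, C y -> eucl_norm (x - eucl_proj C x) <= eucl_norm (x - y).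
Proof.
suff /getPex : exists p, C p /\ forall y, C y -> eucl_norm (x - p) <= eucl_norm (x - y).
  by [].
have cf : {within C, continuous (fun y => eucl_norm (x - y))}.
  exact/continuous_subspaceT/eucl_distr_continuous.
have [p /set_mem Cp pmin] := compact_EVT_min C0 Cc cf.
by exists p; split => // y Cy; apply: pmin; exact: mem_set.
Qed.

Hypothesis Cconv : convex_set (C : set (convex_lmodType 'rV[R]_n)).

(** If the angle were acute, a short move from the projection towards [y] would come closer to
    [x]. *)
Lemma eucl_proj_obtuse x y : C y ->
  eucl_dot (x - eucl_proj C x) (y - eucl_proj C x) <= 0.
Proof.
move=> Cy; have [Cp pmin] := eucl_projP x; set p := eucl_proj C x in Cp pmin *.
rewrite leNgt; apply/negP => h.
set a := eucl_dot _ _ in h; pose b := eucl_dot (y - p) (y - p).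
have b0 : 0 <= b by exact: eucl_dot_ge0.
(* Any positive [t <= 1] with [t * b < 2 * a] gives a contradiction; [a + b] in the denominator
   secures both bounds, also when [b = 0]. *)
pose t := a / (a + b).
have ab0 : 0 < a + b by lra.
have t0 : 0 < t by rewrite divr_gt0.
have t1 : t <= 1 by rewrite ler_pdivrMr//; lra.
have := pmin _ (@convex_setE C _ _ t Cconv _ Cy Cp).
rewrite (ltW t0) t1 => /(_ isT).
have -> : x - (t *: y + (1 - t) *: p) = (x - p) - t *: (y - p).
  by apply/rowP => j; rewrite !mxE; ring.
rewrite eucl_norm_sqr_le (eucl_dot_sqrB (x - p)) !eucl_dotZr eucl_dotZl -/a -/b => h2.
have : 0 <= t * (t * b - 2 * a) by nra.
rewrite pmulr_rge0// subr_ge0.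
have : t * b <= a.
  by rewrite /t mulrAC ler_pdivrMr// ler_pM2l//; lra.
lra.
Qed.

(** The two obtuse-angle inequalities add up to [|p - q|^2 <= <x - y, p - q>] for the projections
    [p], [q]; Cauchy-Schwarz then lets one factor cancel. *)
Lemma eucl_proj_nonexpansive x y :
  eucl_norm (eucl_proj C x - eucl_proj C y) <= eucl_norm (x - y).
Proof.
have [Cp _] := eucl_projP x; have [Cq _] := eucl_projP y.
have h1 := eucl_proj_obtuse x Cq; have h2 := eucl_proj_obtuse y Cp.
move: h1 h2; set p := eucl_proj C x; set q := eucl_proj C y => h1 h2.
have h3 : eucl_dot (p - q) (p - q) <= eucl_dot (x - y) (p - q).
  by move: h1 h2; rewrite !eucl_dotE; lra.
have := le_trans h3 (eucl_cauchy_schwarz _ _); rewrite -sqr_eucl_norm expr2.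
have := eucl_norm_ge0 (p - q); rewrite le_eqVlt => /predU1P[<- _|pq0].
  exact: eucl_norm_ge0.
by rewrite ler_pM2r.
Qed.

Lemma eucl_proj_id x : C x -> eucl_proj C x = x.
Proof.
move=> Cx; have [_ /(_ _ Cx)] := eucl_projP x.
rewrite subrr eucl_norm0 => xp0; apply/esym/eqP; rewrite -subr_eq0; apply/eqP.
by apply: eucl_norm_eq0; apply/eqP; rewrite eq_le xp0 eucl_norm_ge0.
Qed.

Lemma eucl_proj_le x y : C y ->
  eucl_norm (eucl_proj C x - y) <= eucl_norm (x - y).
Proof. by move=> Cy; rewrite -{1}(eucl_proj_id Cy); exact: eucl_proj_nonexpansive. Qed.

Lemma eucl_proj_continuous : continuous (eucl_proj C).
Proof.
apply: (@eucl_lipschitz_continuous _ _ 1) => x y; rewrite mul1r.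
exact: le_trans (mx_norm_le_eucl_norm _) (eucl_proj_nonexpansive x y).
Qed.

End projection.

Lemma eucl_dist_le x y C : C y -> eucl_dist x C <= eucl_norm (x - y).
Proof.
move=> Cy; apply: ge_inf; last by exists y.
by exists 0 => _ [z _ <-]; exact: eucl_norm_ge0.
Qed.

Lemma le_eucl_dist x C (a : R) : C !=set0 ->
  (forall y, C y -> a <= eucl_norm (x - y)) -> a <= eucl_dist x C.
Proof.
move=> [y Cy] aC; apply: lb_le_inf; first by exists (eucl_norm (x - y)), y.
by move=> _ [z Cz <-]; exact: aC.
Qed.

Lemma eucl_dist_ge0 x C : C !=set0 -> 0 <= eucl_dist x C.
Proof. by move=> C0; apply: le_eucl_dist => // y _; exact: eucl_norm_ge0. Qed.

Lemma eucl_dist_lipschitz C x y : C !=set0 ->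
  eucl_dist x C <= eucl_dist y C + eucl_norm (x - y).
Proof.
move=> C0; rewrite -lerBlDr; apply: le_eucl_dist => // z Cz.
rewrite lerBlDr addrC; exact: le_trans (eucl_dist_le x Cz) (ler_eucl_dist_add y x z).
Qed.

Lemma eucl_dist_continuous C : C !=set0 -> continuous (fun x => eucl_dist x C).
Proof.
move=> C0; apply: (@eucl_lipschitz_continuous R^o _ 1) => x y; rewrite mul1r.
rewrite ler_norml.
have := eucl_dist_lipschitz x y C0; have := eucl_dist_lipschitz y x C0.
by rewrite (eucl_distrC y x); lra.
Qed.

End euclidean_space.

(** * Subgradients of convex functions *)

Section subgradients.
Context {R : realType} {n : nat}.
Implicit Types (x y z s : 'rV[R]_n) (f : 'rV[R]_n -> R).

Lemma convex_functionE f x y (t : R) :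
  convex_function [set: convex_lmodType 'rV[R]_n]
    (f : convex_lmodType 'rV[R]_n -> R^o) ->
  0 <= t <= 1 -> f (t *: x + (1 - t) *: y) <= t * f x + (1 - t) * f y.
Proof.
move=> cf /andP[t0 t1].
exact: (cf (Itv01 t0 t1) x y (in_setT _) (in_setT _)).
Qed.

(* One coordinate of the finite-dimensional Hahn-Banach theorem: the slopes
   from the left along [e] stay below those from the right. *)
Lemma subgradient_extension f x s (e : 'rV[R]_n) (H : set 'rV[R]_n) :
  convex_function [set: convex_lmodType 'rV[R]_n]
    (f : convex_lmodType 'rV[R]_n -> R^o) ->
  H 0 -> (forall h h' (a b : R), H h -> H h' -> H (a *: h + b *: h')) ->
  (forall h, H h -> f x + eucl_dot s h <= f (x + h)) ->
  exists r, forall h (t : R), H h -> f x + eucl_dot s h + t * r <= f (x + h + t *: e).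
Proof.
move=> cf H0 Hlin Hs.
(* Slopes along [e] from the left, corrected by [s]. Their supremum serves as the new slope [r]. *)
pose left := [set (f x + eucl_dot s p.1 - f (x + p.1 - p.2 *: e)) / p.2 |
  p in [set p : 'rV[R]_n * R | H p.1 /\ 0 < p.2]].
have slopes h h' (t t' : R) : H h -> H h' -> 0 < t -> 0 < t' ->
    (f x + eucl_dot s h - f (x + h - t *: e)) / t <=
    (f (x + h' + t' *: e) - f x - eucl_dot s h') / t'.
  move=> Hh Hh' t0 t'0.
  have tt0 : 0 < t + t' by rewrite addr_gt0.
  (* With this weight the multiples of [e] cancel, so the convex combination lands in [x + H], where
     [Hs] applies. *)
  pose l := t' / (t + t').
  have l01 : 0 <= l <= 1.
    by rewrite /l divr_ge0 ?(ltW t'0) ?(ltW tt0)//= ler_pdivrMr// mul1r lerDr ltW.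
  have l1E : 1 - l = t / (t + t') by rewrite /l; field; rewrite gt_eqF.
  have := convex_functionE (x + h - t *: e) (x + h' + t' *: e) cf l01.
  have -> : l *: (x + h - t *: e) + (1 - l) *: (x + h' + t' *: e) =
      x + (l *: h + (1 - l) *: h').
    by apply/rowP => j; rewrite !mxE l1E /l; field; rewrite gt_eqF.
  have := Hs _ (Hlin _ _ l (1 - l) Hh Hh'); rewrite !eucl_dotE l1E /l.
  set F := f (x + _); set a := f (x + h - _); set b := f (x + h' + _).
  set u := eucl_dot s h; set v := eucl_dot s h' => h1 h2.
  rewrite ler_pdivrMr// mulrAC ler_pdivlMr//.
  have := le_trans h1 h2.
  rewrite -(ler_pM2r tt0).
  have -> : (f x + (t' / (t + t') * u + t / (t + t') * v)) * (t + t') =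
    f x * (t + t') + t' * u + t * v by field; rewrite gt_eqF.
  have -> : (t' / (t + t') * a + t / (t + t') * b) * (t + t') = t' * a + t * b.
    by field; rewrite gt_eqF.
  lra.
have left0 : left !=set0.
  by exists ((f x + eucl_dot s 0 - f (x + 0 - 1 *: e)) / 1), (0, 1).
have leftub h t : H h -> 0 < t ->
    ubound left ((f (x + h + t *: e) - f x - eucl_dot s h) / t).
  by move=> Hh t0 _ [[h' t'] [/= Hh' t'0] <-]; exact: slopes.
exists (sup left) => h t Hh.
have [t0|t0|->] := ltgtP t 0.
- have : (f x + eucl_dot s h - f (x + h - (- t) *: e)) / (- t) <= sup left.
    apply: ub_le_sup; last by exists (h, - t) => //; split => //=; rewrite oppr_gt0.
    by exists ((f (x + 0 + 1 *: e) - f x - eucl_dot s 0) / 1); exact: leftub.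
  by rewrite ler_pdivrMr ?oppr_gt0// scaleNr opprK; lra.
- have : sup left <= (f (x + h + t *: e) - f x - eucl_dot s h) / t.
    by apply: ge_sup => //; exact: leftub.
  by rewrite ler_pdivlMr//; lra.
- by rewrite scale0r mul0r !addr0; exact: Hs.
Qed.

Lemma subgradient_exists f x :
  convex_function [set: convex_lmodType 'rV[R]_n]
    (f : convex_lmodType 'rV[R]_n -> R^o) ->
  exists s, subdiff f x s.
Proof.
move=> cf.
(* A flag of coordinate subspaces, from the zero space to the whole space: a linear minorant is
   extended one dimension at a time. *)
pose H k := [set h : 'rV[R]_n | forall j : 'I_n, (k <= j)%N -> h 0 j = 0].
suff /(_ n (leqnn n))[s Hs] : forall k, (k <= n)%N ->
    exists s, forall h, H k h -> f x + eucl_dot s h <= f (x + h).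
  exists s => y.
  have /Hs : H n (y - x) by move=> j; rewrite leqNgt ltn_ord.
  by rewrite addrC [in X in _ <= X -> _]addrC subrK addrC.
elim=> [_|k IH kn].
  exists 0 => h Hh; have -> : h = 0 by apply/rowP => j; rewrite mxE Hh.
  by rewrite eucl_dot0r !addr0.
have [s Hs] := IH (ltnW kn); pose k' := Ordinal kn; pose e := delta_mx 0 k' : 'rV[R]_n.
have [||r Hr] := subgradient_extension e cf _ _ Hs.
- by move=> j _; rewrite mxE.
- by move=> h h' a b Hh Hh' j kj; rewrite !mxE Hh// Hh'// !mulr0 addr0.
have dotE (u : 'rV[R]_n) : eucl_dot e u = u 0 k'.
  rewrite /eucl_dot (bigD1 k')//= big1 ?addr0; first by rewrite !mxE !eqxx mul1r.
  by move=> j jk; rewrite mxE (negbTE jk) andbF mul0r.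
(* The correction changes nothing on [H k], which is orthogonal to [e], and makes the slope along
   [e] equal to [r]. *)
exists (s + (r - s 0 k') *: e) => h Hh.
pose h0 := h - h 0 k' *: e.
have Hh0 : H k h0.
  move=> j; rewrite leq_eqVlt => /predU1P[kj|kj]; rewrite !mxE/=.
    have -> : j = k' by exact: val_inj.
    by rewrite eqxx mulr1 subrr.
  by rewrite Hh// (_ : (j == k') = false) ?mulr0 ?subr0//; apply/eqP => jk;
    rewrite jk ltnn in kj.
have := Hr _ (h 0 k') Hh0.
have -> : x + h0 + h 0 k' *: e = x + h by rewrite /h0 -addrA subrK.
apply: le_trans; rewrite /h0 !eucl_dotE !dotE (eucl_dotC s e) dotE; lra.
Qed.

(** The method uses subgradients of the positive part, whereas [Mg] bounds those of [g_a] itself. At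
    a point close to [x] on the segment to [y] the inequality for [pospart f] is one for [f], and
    convexity carries it on to [y]. *)
Lemma subdiff_pospart f x s :
  convex_function [set: convex_lmodType 'rV[R]_n]
    (f : convex_lmodType 'rV[R]_n -> R^o) ->
  0 < f x -> subdiff (pospart f) x s -> subdiff f x s.
Proof.
move=> cf fx0 sx y; set a := eucl_dot s (y - x).
(* Small enough for [f x + t * a] to stay positive, which forces the maximum in [pospart] to be
   attained by [f]. *)
pose t := f x / (2 * (f x + `|a|)).
have a0 : 0 <= `|a| by [].
have den0 : 0 < 2 * (f x + `|a|) by lra.
have t0 : 0 < t by rewrite divr_gt0.
have t1 : t <= 1 by rewrite ler_pdivrMr//; lra.
have pos : 0 < f x + t * a.
  have : - (t * a) <= t * `|a| by rewrite -mulrN ler_pM2l// -normrN ler_norm.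
  have : t * (2 * (f x + `|a|)) = f x by rewrite /t divfK// gt_eqF.
  by have := mulr_gt0 t0 fx0; lra.
have := sx (t *: y + (1 - t) *: x).
have -> : t *: y + (1 - t) *: x - x = t *: (y - x).
  by apply/rowP => j; rewrite !mxE; ring.
rewrite eucl_dotZr -/a /pospart (max_l (ltW fx0)) => h1.
have := convex_functionE y x cf; move=> /(_ t); rewrite (ltW t0) t1 => /(_ isT) h2.
have h3 : f x + t * a <= f (t *: y + (1 - t) *: x).
  by move: h1; rewrite le_max => /orP[//|]; rewrite leNgt pos.
rewrite -(ler_pM2l t0); have := le_trans h3 h2; lra.
Qed.

Lemma pospart_ge0 f x : 0 <= pospart f x.
Proof. by rewrite le_max lexx orbT. Qed.

Lemma pospart_gt0 f x : (0 < pospart f x) = (0 < f x).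
Proof. by rewrite lt_max ltxx orbF. Qed.

Lemma pospart_eq0 f x : f x <= 0 -> pospart f x = 0.
Proof. by move=> fx; rewrite /pospart max_r. Qed.

(** A subgradient at [x], of norm at most [M], bounds [f x - f y] by Cauchy-Schwarz; taking positive
    parts preserves the bound. *)
Lemma convex_pospart_lipschitz f (Y : set 'rV[R]_n) (M : R) :
  convex_function [set: convex_lmodType 'rV[R]_n]
    (f : convex_lmodType 'rV[R]_n -> R^o) ->
  (forall x s, Y x -> subdiff f x s -> eucl_norm s <= M) ->
  forall x y, Y x -> pospart f x <= pospart f y + M * eucl_norm (x - y).
Proof.
move=> cf fM x y Yx; have [s sx] := subgradient_exists x cf.
have sM := fM _ _ Yx sx.
have M0 : 0 <= M * eucl_norm (x - y).
  by rewrite mulr_ge0 ?eucl_norm_ge0// (le_trans _ sM)// eucl_norm_ge0.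
rewrite {1}/pospart ge_max addr_ge0 ?pospart_ge0// andbT.
apply: (@le_trans _ _ (f y + M * eucl_norm (x - y))); last first.
  by rewrite lerD2r le_max lexx.
have := sx y; rewrite -(opprB x y) eucl_dotNr lerBlDr => /le_trans; apply.
rewrite lerD2l (le_trans (eucl_cauchy_schwarz _ _))// ler_wpM2r//.
exact: eucl_norm_ge0.
Qed.

(* The subgradient inequality at [y], where [f] is nonpositive, makes the
   angle term at least [pospart f x]. *)
Lemma feasibility_step_descent f (Y : set 'rV[R]_n) (M b : R) (x y s : 'rV[R]_n) :
  compact Y -> convex_set (Y : set (convex_lmodType 'rV[R]_n)) ->
  convex_function [set: convex_lmodType 'rV[R]_n]
    (f : convex_lmodType 'rV[R]_n -> R^o) ->
  (forall x s, Y x -> subdiff f x s -> eucl_norm s <= M) ->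
  0 < M -> 0 < b -> b < 2 -> Y x -> Y y -> f y <= 0 ->
  (0 < pospart f x -> subdiff (pospart f) x s) ->
  eucl_norm (eucl_proj Y
    (x - (b * (pospart f x / eucl_norm s ^+ 2)) *: s) - y) ^+ 2 <=
  eucl_norm (x - y) ^+ 2 - b * (2 - b) / M ^+ 2 * pospart f x ^+ 2.
Proof.
move=> cY cvY cf fM M0 b0 b2 Yx Yy fy0 sP.
have Y0 : Y !=set0 by exists y.
have := eucl_proj_le Y0 cY cvY (x - (b * (pospart f x / eucl_norm s ^+ 2)) *: s) Yy.
rewrite -ler_sqr ?nnegrE ?eucl_norm_ge0// => /le_trans; apply.
(* When [pospart f x] vanishes the step is zero, whatever [s] is. *)
have := pospart_ge0 f x; rewrite le_eqVlt => /predU1P[<-|fx0].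
  by rewrite mul0r mulr0 scale0r subr0 expr0n mulr0 subr0.
have sx := sP fx0.
have sM : eucl_norm s <= M.
  by apply: (fM x) => //; apply: subdiff_pospart => //; rewrite -pospart_gt0.
have angle : pospart f x <= eucl_dot s (x - y).
  by have := sx y; rewrite (pospart_eq0 fy0) -(opprB x y) eucl_dotNr; lra.
have s0 : 0 < eucl_norm s.
  rewrite lt_neqAle eucl_norm_ge0 andbT eq_sym; apply/eqP => /eucl_norm_eq0 s0.
  by move: angle; rewrite s0 eucl_dotC eucl_dot0r leNgt fx0.
rewrite addrAC !(sqr_eucl_norm (_ - _)).
rewrite (eucl_dot_sqrB (x - y)) !eucl_dotZr eucl_dotZl -!sqr_eucl_norm (eucl_dotC _ s).
set p := pospart f x in fx0 angle *; set a := eucl_dot _ _ in angle *.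
set r := eucl_norm s in s0 sM *.
have -> : b * (p / r ^+ 2) * (b * (p / r ^+ 2) * r ^+ 2) = b ^+ 2 * p ^+ 2 / r ^+ 2.
  by field; rewrite gt_eqF.
have h1 : b * (p / r ^+ 2) * p <= b * (p / r ^+ 2) * a.
  by rewrite ler_wpM2l// mulr_ge0 ?ltW// divr_gt0// exprn_gt0.
(* The net coefficient of [p ^+ 2] is [- b * (2 - b) / r ^+ 2]; as [0 < b < 2], replacing [r] by its
   bound [M] only weakens the decrease. *)
have h2 : b * (2 - b) / M ^+ 2 * p ^+ 2 <= b * (2 - b) / r ^+ 2 * p ^+ 2.
  have bb0 : 0 <= b * (2 - b) by rewrite mulr_ge0 ?subr_ge0 ?ltW.
  rewrite ler_wpM2r ?sqr_ge0// ler_wpM2l// lef_pV2 ?posrE ?exprn_gt0//.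
  by rewrite lerXn2r// nnegrE ltW.
have h3 : b * (2 - b) / r ^+ 2 * p ^+ 2 =
    2 * (b * (p / r ^+ 2) * p) - b ^+ 2 * p ^+ 2 / r ^+ 2.
  by field; rewrite gt_eqF.
lra.
Qed.

End subgradients.

(** * Borel measurability in R^n *)

Section borel_row_vectors.
Context {R : realType} {n : nat}.
Implicit Types (x y : 'rV[R]_n).

Lemma rat_rV_dense x (e : R) : 0 < e ->
  exists r : 'rV[rat]_n, ball x e (map_mx ratr r).
Proof.
move=> e0.
have /choice[r rE] (j : 'I_n) : exists r : rat, `|x 0 j - ratr r| < e.
  have [|r] := @rat_in_itvoo R (x 0 j - e) (x 0 j + e); first lra.
  by rewrite in_itv/= => ?; exists r; rewrite ltr_norml; lra.
exists (\row_j r j); split => // i j; rewrite ord1 !mxE; exact: rE.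
Qed.

(** Rational points may all miss [C], so their projections are used; nonexpansiveness keeps these as
    close to a point of [C] as before. *)
Lemma compact_convex_separable (C : set 'rV[R]_n) :
  C !=set0 -> compact C -> convex_set (C : set (convex_lmodType 'rV[R]_n)) ->
  exists u : nat -> 'rV[R]_n, (forall k, C (u k)) /\
    forall x (e : R), C x -> 0 < e -> exists k, eucl_norm (x - u k) < e.
Proof.
move=> C0 cC cvC.
pose v (r : 'rV[rat]_n) := eucl_proj C (map_mx ratr r).
exists (fun k => v (odflt 0 (unpickle k))); split.
  by move=> k; have [] := eucl_projP C0 cC (map_mx ratr (odflt 0 (unpickle k))).
move=> x e Cx e0.
(* Passing from the sup norm to the Euclidean norm costs a factor [n]; the successor covers
   dimension zero. *)
have e1 : 0 < e / n.+1%:R by rewrite divr_gt0.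
have [r] := rat_rV_dense x e1; rewrite mx_norm_ball /ball_/= => xr.
exists (pickle r); rewrite pickleK/= -{1}(eucl_proj_id C0 cC Cx).
apply: le_lt_trans (eucl_proj_nonexpansive C0 cC cvC _ _) _.
apply: le_lt_trans (eucl_norm_le_mx_norm _) _.
apply: (@le_lt_trans _ _ (n.+1%:R * `|x - map_mx ratr r|)).
  by rewrite ler_wpM2r// ler_nat.
by rewrite mulrC -ltr_pdivlMr.
Qed.

Lemma continuous_borel_measurable (f : 'rV[R]_n -> R) :
  continuous f -> measurable_fun setT (f : borel_rV R n -> R).
Proof.
move=> /continuousP cf; apply: (measurability _ (RGenOpens.measurableE R)).
move=> _ [_ [a [b ->] <-]]; rewrite setTI.
by apply: sub_sigma_algebra; apply: cf; exact: interval_open.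
Qed.

Lemma continuous_borel_rV_measurable m (f : 'rV[R]_n -> 'rV[R]_m) :
  continuous f -> measurable_fun setT (f : borel_rV R n -> borel_rV R m).
Proof.
move=> /continuousP cf; apply: (@measurability _ _ (borel_rV R n) (borel_rV R m) _ f
  (@open 'rV[R]_m)) => //.
by move=> _ [U oU <-]; rewrite setTI; apply: sub_sigma_algebra; exact: cf.
Qed.

Lemma coord_borel_measurable j :
  measurable_fun setT (fun x : borel_rV R n => (x : 'rV[R]_n) 0 j : R).
Proof.
apply: (@continuous_borel_measurable (fun x => x 0 j)).
exact: (@coord_continuous R 1 n 0 j).
Qed.

Context {d : measure_display} {T : measurableType d}.

(** An open set is the union of the countably many rational boxes that it contains, and membership
    in a box is a finite conjunction of conditions on coordinates. *)
Lemma measurable_borel_rV (f : T -> 'rV[R]_n) :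
  (forall j, measurable_fun setT (fun w => f w 0 j)) ->
  measurable_fun setT (f : T -> borel_rV R n).
Proof.
move=> mf; apply: (@measurability _ _ T (borel_rV R n) _ f (@open 'rV[R]_n)) => //.
move=> _ [U oU <-]; rewrite setTI.
pose box (p : 'rV[rat]_n * nat) : set 'rV[R]_n :=
  ball (map_mx ratr p.1 : 'rV[R]_n) p.2.+1%:R^-1.
pose F p := if `[< box p `<=` U >] then f @^-1` box p else set0.
have -> : f @^-1` U = \bigcup_p F p.
  apply/seteqP; split=> [w /= Uw|w [p _]]; last first.
    by rewrite /F; case: asboolP => // pU /pU.
  have /nbhs_ballP[e /= e0 eU] : nbhs (f w) U by exact: open_nbhs_nbhs.
  have e20 : 0 < e / 2 by rewrite divr_gt0.
  have [k ke] := ltr_add_invr e20; rewrite add0r in ke.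
  have k0 : 0 < (k.+1%:R^-1 : R) by rewrite invr_gt0.
  have [r rw] := rat_rV_dense (f w) k0.
  exists (r, k) => //; rewrite /F; case: asboolP => [_|]; first exact: ball_sym.
  case=> y ry; apply: eU; rewrite (splitr e).
  by apply: ball_triangle (ball_sym (ball_sym (le_ball (ltW ke) rw)))
    (le_ball (ltW ke) ry).
apply: countable_bigcupT_measurable => [|p]; first exact: countableP.
rewrite /F; case: asboolP => // _.
have -> : f @^-1` box p = \big[setI/setT]_(j <- enum 'I_n)
    (fun w => f w 0 j) @^-1` ball (ratr (p.1 0 j) : R) p.2.+1%:R^-1.
  rewrite -bigcap_seq; apply/seteqP; split=> w /=.
    by case=> _ h j _; have := h 0 j; rewrite mxE.
  move=> h; split => [|i j]; first by rewrite invr_gt0.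
  by rewrite ord1 mxE; apply: h; rewrite /= mem_enum.
apply: bigsetI_measurable => j _.
by rewrite -[X in measurable X]setTI; apply: mf => //; exact: measurable_ball.
Qed.

Lemma measurable_borel_coord (f : T -> borel_rV R n) j :
  measurable_fun setT f -> measurable_fun setT (fun w => (f w : 'rV[R]_n) 0 j).
Proof. exact: (measurableT_comp (coord_borel_measurable j)). Qed.

Lemma measurable_eucl_norm (f : T -> borel_rV R n) :
  measurable_fun setT f -> measurable_fun setT (fun w => eucl_norm (f w : 'rV[R]_n)).
Proof.
move=> mf.
have -> : (fun w => eucl_norm (f w : 'rV[R]_n)) =
    (fun x : borel_rV R n => eucl_norm (0 - (x : 'rV[R]_n))) \o f.
  by apply/funext => w /=; rewrite sub0r eucl_normN.
apply: measurableT_comp mf; apply: continuous_borel_measurable.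
exact: eucl_distr_continuous.
Qed.

Lemma measurable_borel_rVB (f g : T -> borel_rV R n) :
  measurable_fun setT f -> measurable_fun setT g ->
  measurable_fun setT (fun w => (f w : 'rV[R]_n) - g w : borel_rV R n).
Proof.
move=> mf mg; apply: measurable_borel_rV => j.
under eq_fun do rewrite !mxE.
by apply: measurable_funB; exact: measurable_borel_coord.
Qed.

Lemma measurable_borel_rVZ (t : T -> R) (f : T -> borel_rV R n) :
  measurable_fun setT t -> measurable_fun setT f ->
  measurable_fun setT (fun w => t w *: (f w : 'rV[R]_n) : borel_rV R n).
Proof.
move=> mt mf; apply: measurable_borel_rV => j.
under eq_fun do rewrite !mxE.
by apply: measurable_funM => //; exact: measurable_borel_coord.
Qed.

(* By the Lipschitz bound, [phi w (Z w)] is the infimum over a dense sequence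
   [u] in [Y] of [phi w (u k) + L * eucl_norm (Z w - u k)]. *)
Lemma measurable_lipschitz_parameter (phi : T -> 'rV[R]_n -> R)
    (Y : set 'rV[R]_n) (L : R) (Z : T -> borel_rV R n) :
  Y !=set0 -> compact Y -> convex_set (Y : set (convex_lmodType 'rV[R]_n)) ->
  (forall y, Y y -> measurable_fun setT (phi ^~ y)) ->
  (forall w x y, Y x -> Y y -> phi w x <= phi w y + L * eucl_norm (x - y)) ->
  measurable_fun setT Z -> (forall w, Y (Z w)) ->
  measurable_fun setT (fun w => phi w (Z w)).
Proof.
move=> Y0 cY cvY mphi phiL mZ YZ.
have [u [Yu uY]] := compact_convex_separable Y0 cY cvY.
apply: (measurability _ (RGenInftyO.measurableE R)) => //.
move=> _ [_ [a ->] <-]; rewrite setTI.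
(* An infimum is strictly below [a] exactly when one of its terms is, so the sublevel set becomes a
   countable union. *)
have -> : (fun w => phi w (Z w)) @^-1` `]-oo, a[%classic =
    \bigcup_k ((fun w => phi w (u k) + L * eucl_norm ((Z w : 'rV[R]_n) - u k))
      @^-1` `]-oo, a[%classic).
  apply/seteqP; split=> w /=; rewrite in_itv/=; last first.
    case=> k _ /=; rewrite in_itv/=; apply: le_lt_trans.
    by apply: phiL.
  (* The [k]-th term exceeds [phi w (Z w)] by at most twice [L] times the distance to [u k]: once by
     the Lipschitz bound, once by the added penalty. *)
  move=> wa; pose L1 := 2 * `|L| + 1.
  have L10 : 0 < L1 by rewrite ltr_wpDl// mulr_ge0.
  have [||k] := uY (Z w) ((a - phi w (Z w)) / L1); [exact: YZ|by rewrite divr_gt0// subr_gt0|].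
  rewrite ltr_pdivlMr// => kL; exists k => //=; rewrite in_itv/=.
  have := phiL w _ _ (Yu k) (YZ w); rewrite (eucl_distrC (u k)).
  have := eucl_norm_ge0 ((Z w : 'rV[R]_n) - u k).
  move: kL; rewrite /L1; set t := eucl_norm _ => kL t0.
  have : L * t <= `|L| * t by rewrite ler_wpM2r// ler_norm.
  by nra.
apply: bigcup_measurable => k _; rewrite -[X in measurable X]setTI.
have : measurable_fun setT (fun w => phi w (u k) + L * eucl_norm ((Z w : 'rV[R]_n) - u k)).
  apply: measurable_funD; first exact: mphi.
  apply: measurable_funM; first exact: measurable_cst.
  apply: measurable_eucl_norm; apply: measurable_borel_rVB => //.
by apply=> //; exact: measurable_itv.
Qed.

End borel_row_vectors.

(** * Conditioning *)

Section conditioning.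
Context {d : measure_display} {T : measurableType d} {R : realType}
  (P : probability T R).
Implicit Types (G : set (set T)).

Lemma sigma_sub_measurable G :
  G `<=` measurable -> <<s G >> `<=` @measurable d T.
Proof.
by move=> Gm; apply: smallest_sub => //; exact: sigma_algebra_measurable.
Qed.

Lemma measurable_wrtW G G' {d' : measure_display} {T' : measurableType d'}
    (f : T -> T') :
  G `<=` <<s G' >> -> measurable_wrt G f -> measurable_wrt G' f.
Proof.
move=> GG' mf _ B mB; have := mf measurableT B mB.
rewrite !setTI; apply: smallest_sub => //; exact: smallest_sigma_algebra.
Qed.

Lemma measurable_wrt_measurable G {d' : measure_display} {T' : measurableType d'}
    (f : T -> T') :
  G `<=` measurable -> measurable_wrt G f -> measurable_fun setT f.
Proof.
move=> Gm mf _ B mB; have := mf measurableT B mB.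
by rewrite !setTI; exact: sigma_sub_measurable.
Qed.

Lemma measurable_wrt_sigma_of G {d' : measure_display} {T' : measurableType d'}
    (f : T -> T') :
  sigma_of f `<=` <<s G >> -> measurable_wrt G f.
Proof. by move=> fG _ B mB; apply: fG; exists B. Qed.

(* [B] is cut into countably many events on which [Z] is almost constant. *)
Lemma integral_frozen_parameter {n : nat} G (Y : set 'rV[R]_n)
    (delta : 'rV[R]_n -> R) (phi : T -> 'rV[R]_n -> R) (L : R)
    (Z : T -> 'rV[R]_n) :
  G `<=` measurable -> Y !=set0 -> compact Y ->
  convex_set (Y : set (convex_lmodType 'rV[R]_n)) -> 0 <= L ->
  (forall y, Y y -> 0 <= delta y) ->
  (forall w y, Y y -> 0 <= phi w y) ->
  (forall x y, Y x -> Y y -> delta x <= delta y + L * eucl_norm (x - y)) ->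
  (forall w x y, Y x -> Y y -> phi w x <= phi w y + L * eucl_norm (x - y)) ->
  (forall y, Y y -> measurable_fun setT (phi ^~ y)) ->
  measurable_wrt G (Z : T -> borel_rV R n) -> (forall w, Y (Z w)) ->
  (forall y B, Y y -> <<s G >> B ->
     (\int[P]_(w in B) (delta y)%:E <= \int[P]_(w in B) (phi w y)%:E)%E) ->
  forall B, <<s G >> B ->
    (\int[P]_(w in B) (delta (Z w))%:E <= \int[P]_(w in B) (phi w (Z w))%:E)%E.
Proof.
move=> Gm Y0 cY cvY L0 delta0 phi0 deltaL phiL mphi mZ YZ le_const B GB.
have sGm := sigma_sub_measurable Gm.
have mZT : measurable_fun setT (Z : T -> borel_rV R n).
  exact: measurable_wrt_measurable mZ.
have mB := sGm _ GB.
have mphiZ : measurable_fun setT (fun w => phi w (Z w)).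
  exact: measurable_lipschitz_parameter phiL mZT YZ.
have mdeltaZ : measurable_fun setT (fun w => delta (Z w)).
  by apply: (@measurable_lipschitz_parameter _ _ _ _ (fun=> delta) _ L
    (Z : T -> borel_rV R n) Y0).
have [u [Yu uY]] := compact_convex_separable Y0 cY cvY.
apply/lee_addgt0Pr => e e0.
(* Freezing [Z] at [u k] costs [L * eta] in [delta] and as much in [phi]; the total [2 * L * eta] is
   at most [e]. *)
pose eta := e / (2 * L + 1).
have L1 : 0 < 2 * L + 1 by rewrite ltr_wpDl// mulr_ge0.
have eta0 : 0 < eta by rewrite divr_gt0.
have Leta0 : 0 <= L * eta by rewrite mulr_ge0// ltW.
have Leta20 : 0 <= 2 * L * eta by rewrite -mulrA mulr_ge0.
pose C k : set T := [set w | eucl_norm (Z w - u k) < eta].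
have GC k : <<s G >> (C k).
  have : measurable_fun [set: g_sigma_algebraType G] (fun w => eucl_norm (Z w - u k)).
    by apply: measurable_eucl_norm; exact: measurable_borel_rVB.
  move=> /(_ measurableT `]-oo, eta[%classic (measurable_itv _)).
  by rewrite setTI set_itvNyo.
(* Making the cells disjoint keeps them in [<<s G >>], the events to which [le_const] applies. *)
pose E k := B `&` seqDU C k.
have GE k : <<s G >> (E k).
  apply: (@measurableI _ (g_sigma_algebraType G)) => //.
  by apply: (@seqDU_measurable _ (g_sigma_algebraType G)).
have mE k : measurable (E k) by exact: sGm.
have BE : B = \bigcup_k E k.
  rewrite -setI_bigcupr -seqDU_bigcup_eq; apply/esym/setIidPl => w _.
  by have [k ?] := uY (Z w) eta (YZ w) eta0; exists k.
have tE : trivIset setT E by apply: trivIset_setIl; exact: trivIset_seqDU.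
have Ceta k w : E k w -> eucl_norm (Z w - u k) <= eta.
  by move=> [_ /(@subset_seqDU _ C k w) ?]; exact: ltW.
have le_cell k : (\int[P]_(w in E k) (delta (Z w))%:E <=
    \int[P]_(w in E k) (phi w (Z w) + 2 * L * eta)%:E)%E.
  apply: (@le_trans _ _ (\int[P]_(w in E k) (delta (u k) + L * eta)%:E)%E).
    apply: ge0_le_integral => //.
    - by move=> w _; rewrite lee_fin delta0.
    - by apply/measurable_EFinP/measurable_funTS; exact: mdeltaZ.
    - by move=> w Ew; rewrite lee_fin (le_trans (deltaL _ _ (YZ w) (Yu k)))//
        lerD2l ler_wpM2l// Ceta.
  apply: (@le_trans _ _ (\int[P]_(w in E k) (phi w (u k) + L * eta)%:E)%E).
    under eq_integral do rewrite EFinD.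
    under [leRHS]eq_integral do rewrite EFinD.
    rewrite !ge0_integralD//.
    - by rewrite leeD2r// le_const.
    - by move=> w _; rewrite lee_fin phi0.
    - by apply/measurable_EFinP/measurable_funTS; exact: (mphi _ (Yu k)).
    - by move=> w _; rewrite lee_fin delta0.
  apply: ge0_le_integral => //.
  - by move=> w _; rewrite lee_fin addr_ge0// phi0.
  - apply/measurable_EFinP/measurable_funD => //.
    by apply: measurable_funTS; exact: (mphi _ (Yu k)).
  - apply/measurable_EFinP/measurable_funD => //.
    by apply: measurable_funTS; exact: mphiZ.
  - move=> w Ew; rewrite lee_fin.
    have := phiL w _ _ (Yu k) (YZ w); rewrite eucl_distrC.
    have : L * eucl_norm (Z w - u k) <= L * eta by rewrite ler_wpM2l// Ceta.
    lra.
have phi2 w : 0 <= phi w (Z w) + 2 * L * eta.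
  by rewrite addr_ge0// phi0.
have mphi2 : measurable_fun setT (fun w => phi w (Z w) + 2 * L * eta).
  exact: measurable_funD.
have -> : (\int[P]_(w in B) (delta (Z w))%:E =
    \sum_(k <oo) \int[P]_(w in E k) (delta (Z w))%:E)%E.
  rewrite {1}BE ge0_integral_bigcup//.
    by apply/measurable_EFinP/measurable_funTS; exact: mdeltaZ.
  by move=> w _; rewrite lee_fin delta0.
apply: (@le_trans _ _ (\int[P]_(w in B) (phi w (Z w) + 2 * L * eta)%:E)%E).
  rewrite BE ge0_integral_bigcup//.
    apply: lee_nneseries => // k _ _.
    by apply: integral_ge0 => w _; rewrite lee_fin delta0.
  by apply/measurable_EFinP/measurable_funTS; exact: mphi2.
  by move=> w _; rewrite lee_fin.
under eq_integral do rewrite EFinD.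
rewrite ge0_integralD//.
- rewrite leeD2l// integral_cst// -[leRHS]mule1.
  apply: lee_pmul => //; last exact: probability_le1.
  by rewrite lee_fin /eta mulrA ler_pdivrMr// mulrDr mulr1 mulrC lerDl ltW.
- by move=> w _; rewrite lee_fin phi0.
- by apply/measurable_EFinP/measurable_funTS; exact: mphiZ.
Qed.

(** Restricting [P] to [B] and pushing it forward along [f] gives, by independence, [P B] times the
    law of [f]. *)
Lemma ge0_integral_independent G {d' : measure_display} {T' : measurableType d'}
    (f : T -> T') (h : T' -> \bar R) B :
  measurable B -> G B -> measurable_fun setT f -> independent_of P G f ->
  measurable_fun setT h -> (forall y, 0 <= h y)%E ->
  (\int[P]_(w in B) h (f w) = P B * \int[P]_w h (f w))%E.
Proof.
move=> mB GB mf Gf mh h0.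
have -> : (\int[P]_(w in B) h (f w) = \int[mrestr P mB]_w h (f w))%E.
  rewrite [RHS](@ge0_negligible_integral _ _ _ _ _ (~` B))//=.
  - rewrite setTD setCK; apply: eq_measure_integral => A mA AB.
    by transitivity (P (A `&` B)) => //; rewrite setIidl.
  - exact: measurableC.
  - exact: measurableT_comp.
  - by transitivity (P (~` B `&` B)) => //; rewrite setICl measure0.
have r0 : (0 <= fine (P B))%R by rewrite fine_ge0.
have PBE : ((NngNum r0)%:num%:E = P B)%E by rewrite /= fineK// fin_num_measure.
transitivity (\int[pushforward (mrestr P mB) f]_y h y)%E.
  by rewrite ge0_integral_pushforward.
rewrite (@eq_measure_integral _ _ _ _ (mscale (NngNum r0) (pushforward P f))).
  by rewrite ge0_integral_mscale// PBE ge0_integral_pushforward.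
move=> A mA _; transitivity (P (f @^-1` A `&` B)) => //.
transitivity ((NngNum r0)%:num%:E * P (f @^-1` A))%E => //.
by rewrite PBE setIC Gf.
Qed.

(** The event [U < Z] belongs to the conditioning sigma-algebra, so the integral inequality may be
    tested on it; there it forces [Z = U] almost surely, against strictness. *)
Lemma cond_exp_le G (X Z U : T -> R) :
  G `<=` measurable -> is_cond_exp P G X Z ->
  measurable_wrt G U -> P.-integrable setT (EFin \o U) ->
  (forall B, <<s G >> B ->
    (\int[P]_(w in B) (X w)%:E <= \int[P]_(w in B) (U w)%:E)%E) ->
  {ae P, forall w, Z w <= U w}.
Proof.
move=> Gm [mZ iZ ZX] mU iU XU.
have mZT := measurable_wrt_measurable Gm mZ.
have mUT := measurable_wrt_measurable Gm mU.
pose B := [set w | U w < Z w].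
have GB : <<s G >> B.
  have : measurable_fun [set: g_sigma_algebraType G] (fun w => U w < Z w).
    exact: measurable_fun_ltr.
  by move=> /(_ measurableT [set true]); rewrite setTI; apply.
have mB : measurable B by exact: sigma_sub_measurable GB.
have iZB : P.-integrable B (EFin \o Z) by exact: integrableS iZ.
have iUB : P.-integrable B (EFin \o U) by exact: integrableS iU.
have int0 : (\int[P]_(w in B) `|(Z w)%:E - (U w)%:E| = 0)%E.
  apply/eqP; rewrite eq_le integral_ge0// andbT.
  rewrite (eq_integral (fun w => (Z w)%:E - (U w)%:E)%E); last first.
    by move=> w /set_mem Bw; rewrite gee0_abs// sube_ge0// lee_fin ltW.
  rewrite integralB//=; rewrite sube_le0 ZX//; exact: XU.
have : ae_eq P B (fun w => (Z w)%:E - (U w)%:E)%E (cst 0%E).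
  apply/ae_eq_integral_abs => //.
  by apply: emeasurable_funB; apply/measurable_EFinP/measurable_funTS.
apply: filterS => w h; rewrite leNgt; apply/negP => Bw.
move: (h Bw) => /= /eqP; rewrite -EFinB eqe subr_eq0 => /eqP ZU.
by move: Bw; rewrite ZU ltxx.
Qed.

End conditioning.

(** Since [a ^+ 2 - b ^+ 2 = (a - b) * (a + b)], squaring a nonnegative function bounded by [m]
    multiplies its Lipschitz constant by [2 * m]. *)
Lemma ler_sqr_lipschitz (R : realDomainType) (a b m t : R) :
  0 <= a <= m -> 0 <= b <= m -> a <= b + t -> 0 <= t ->
  a ^+ 2 <= b ^+ 2 + 2 * m * t.
Proof.
move=> /andP[a0 am] /andP[b0 bm] abt t0.
have [ab|ba] := leP a b; first by nra.
by nra.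
Qed.

(** * Integrals of bounded functions and countably many almost sure events *)

Section integrals.
Context {d : measure_display} {T : measurableType d} {R : realType}
  (P : probability T R).

Lemma bounded_integrable (f : T -> R) (M : R) :
  measurable_fun setT f -> (forall w, 0 <= f w <= M) ->
  P.-integrable setT (EFin \o f).
Proof.
move=> mf f0M; apply: (@measurable_bounded_integrable _ _ _ P f setT) => //.
  by apply: le_lt_trans (probability_le1 P measurableT) _; rewrite ltry.
exists M; split; first exact: num_real.
move=> y My w _ /=; have /andP[f0 fM] := f0M w.
by rewrite ger0_norm// (le_trans fM)// ltW.
Qed.

Lemma ge0_integral_affine (f : T -> R) (B : set T) (a b : R) :
  measurable B -> measurable_fun setT f -> (forall w, 0 <= f w) ->
  0 <= a -> 0 <= b ->
  (\int[P]_(w in B) (a * f w + b)%:E =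
   a%:E * \int[P]_(w in B) (f w)%:E + b%:E * P B)%E.
Proof.
move=> mB mf f0 a0 b0.
under eq_integral do rewrite EFinD EFinM.
rewrite ge0_integralD//=.
- rewrite ge0_integralZl_EFin//; first by rewrite integral_cst.
    by move=> w _; rewrite lee_fin.
  by apply/measurable_EFinP/measurable_funTS.
- by move=> w _; rewrite -EFinM lee_fin mulr_ge0.
- apply/measurable_EFinP/measurable_funM => //.
  exact: measurable_funTS.
Qed.

Lemma ae_forall_rat (Q : rat -> T -> Prop) :
  (forall r, {ae P, forall w, Q r w}) -> {ae P, forall w, forall r, Q r w}.
Proof.
move=> Qae.
have /ae_foralln : forall k, {ae P, forall w, Q (odflt 0 (unpickle k)) w}.
  by move=> k; exact: Qae.
by apply: filterS => w Qw r; have := Qw (pickle r); rewrite pickleK.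
Qed.

End integrals.

(** * Measurability of the updates *)

Section measurability_of_the_method.
Context {R : realType} {n : nat} {d dA dXi : measure_display}
  {T : measurableType d} {A : measurableType dA} {Xi : measurableType dXi}.
Variable Y : set 'rV[R]_n.
Hypotheses (Y0 : Y !=set0) (cY : compact Y)
  (cvY : convex_set (Y : set (convex_lmodType 'rV[R]_n))).

Lemma measurable_eucl_proj (f : T -> borel_rV R n) :
  measurable_fun setT f ->
  measurable_fun setT (fun w => eucl_proj Y (f w) : borel_rV R n).
Proof.
apply: (@measurableT_comp _ _ _ _ _ _ (eucl_proj Y : borel_rV R n -> borel_rV R n)).
by apply: continuous_borel_rV_measurable; exact: eucl_proj_continuous.
Qed.

(** Serves both half-steps of an iteration, with [y] equal to [x] and then to the intermediate
    point. The oracle is measurable on [Y] times [Xi] only, hence the condition on the values of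
    [y]. *)
Lemma measurable_extragradient_step (F : 'rV[R]_n -> Xi -> 'rV[R]_n) (a : R)
    (x y : T -> borel_rV R n) (xi : T -> Xi) :
  closed Y ->
  measurable_fun (Y `*` [set: Xi] : set (borel_rV R n * Xi))
     (fun p : borel_rV R n * Xi => F p.1 p.2 : borel_rV R n) ->
  measurable_fun setT x -> measurable_fun setT y -> (forall w, Y (y w)) ->
  measurable_fun setT xi ->
  measurable_fun setT
    (fun w => eucl_proj Y ((x w : 'rV[R]_n) - a *: F (y w) (xi w)) : borel_rV R n).
Proof.
move=> clY mF mx my Yy mxi; apply: measurable_eucl_proj.
apply: (@measurable_borel_rVB _ _ _ _ x (fun w => a *: F (y w) (xi w))) => //.
apply: (@measurable_borel_rVZ _ _ _ _ (fun=> a) (fun w => F (y w) (xi w))) => //.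
have mY : measurable (Y : set (borel_rV R n)).
  rewrite -(setCK Y); apply: measurableC; apply: sub_sigma_algebra.
  exact: closed_openC.
apply: (@measurable_comp _ _ _ T (borel_rV R n * Xi)%type (borel_rV R n)
  (Y `*` [set: Xi]) (fun p => F p.1 p.2) setT (fun w => (y w, xi w)) _ _ mF).
- exact: measurableX.
- by move=> _ [w _ <-]; split => //=; exact: Yy.
- exact: measurable_fun_pair.
Qed.

Lemma measurable_feasibility_step (p : T -> R) (b : R) (z s : T -> borel_rV R n) :
  measurable_fun setT p -> measurable_fun setT z -> measurable_fun setT s ->
  measurable_fun setT (fun w => eucl_proj Y ((z w : 'rV[R]_n) -
    (b * (p w / eucl_norm (s w : 'rV[R]_n) ^+ 2)) *: (s w : 'rV[R]_n)) : borel_rV R n).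
Proof.
move=> mp mz ms; apply: measurable_eucl_proj.
apply: (@measurable_borel_rVB _ _ _ _ z) => //.
apply: (@measurable_borel_rVZ _ _ _ _
  (fun w => b * (p w / eucl_norm (s w : 'rV[R]_n) ^+ 2)) s) => //.
apply: measurable_funM => //; apply: measurable_funM => //.
(* The inverse is written as a real power, which is measurable everywhere; both agree on nonnegative
   numbers, zero included. *)
under eq_fun do rewrite -powR_inv1 ?sqr_ge0//.
apply: (@measurableT_comp _ _ _ _ _ _ (fun r : R => r `^ (-1))).
  exact: measurable_powR.
by apply: measurable_funX; exact: measurable_eucl_norm.
Qed.

End measurability_of_the_method.

(** * Inclusions between the sigma-algebras of the past *)

Section filtrations.
Context {R : realType} {n : nat} {d dA dXi : measure_display}
  {T : measurableType d} {A : measurableType dA} {Xi : measurableType dXi}.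
Variables (x0 : T -> 'rV[R]_n) (xi1 xi2 : nat -> T -> Xi)
  (omega : nat -> nat -> T -> A) (N : nat -> nat).
Local Notation F := (filtration x0 xi1 xi2 omega N).
Local Notation I := (inner_filtration x0 xi1 xi2 omega N).

Lemma filtration_sigma k : <<s F k >> = F k.
Proof. exact/sigma_algebra_id/smallest_sigma_algebra. Qed.

Lemma inner_filtration_sigma k i : <<s I k i >> = I k i.
Proof. exact/sigma_algebra_id/smallest_sigma_algebra. Qed.

Lemma filtration_measurable k :
  measurable_fun setT (x0 : T -> borel_rV R n) ->
  (forall k, measurable_fun setT (xi1 k)) ->
  (forall k, measurable_fun setT (xi2 k)) ->
  (forall k i, measurable_fun setT (omega k i)) ->
  F k `<=` measurable.
Proof.
move=> mx m1 m2 mo; apply: sigma_sub_measurable => B [[[U mU <-]|]|].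
- exact: mx.
- by case=> t _ [] [U mU <-]; [exact: m1|exact: m2].
- by case=> t _ [i _ [U mU <-]]; exact: mo.
Qed.

Lemma inner_filtration_measurable k i :
  measurable_fun setT (x0 : T -> borel_rV R n) ->
  (forall k, measurable_fun setT (xi1 k)) ->
  (forall k, measurable_fun setT (xi2 k)) ->
  (forall k i, measurable_fun setT (omega k i)) ->
  I k i `<=` measurable.
Proof.
move=> mx m1 m2 mo; apply: sigma_sub_measurable => B [|].
  exact: filtration_measurable.
by case=> j _ [U mU <-]; exact: mo.
Qed.

Lemma sub_filtration k l : (k <= l)%N -> F k `<=` F l.
Proof.
move=> kl; apply: sub_sigma_algebra2; apply: setUSS.
  apply: setUS => B [t /andP[t1 tk] Bt]; exists t => //=.
  by rewrite t1 (leq_trans tk).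
by move=> B [t /andP[t1 tk] Bt]; exists t => //=; rewrite t1 (leq_trans tk).
Qed.

Lemma sub_inner_filtration k i : F k.-1 `<=` I k i.
Proof. by move=> B FB; apply: sub_sigma_algebra; left. Qed.

Lemma sub_inner_filtrationS k i j : (i <= j)%N -> I k i `<=` I k j.
Proof.
move=> ij; apply: sub_sigma_algebra2; apply: setUS => B [t /andP[t1 ti] Bt].
by exists t => //=; rewrite t1 (leq_trans ti).
Qed.

Lemma inner_filtration_sub k : (1 <= k)%N -> I k (N k) `<=` F k.
Proof.
move=> k1 B; rewrite -(filtration_sigma k).
apply: sub_sigma_algebra2 => {}B [|[j jN Bj]].
  by apply: sub_filtration; exact: leq_pred.
by apply: sub_sigma_algebra; right; exists k => /=; [rewrite k1 leqnn|exists j].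
Qed.

Lemma sigma_of_x0_sub k : sigma_of (x0 : T -> borel_rV R n) `<=` F k.
Proof. by move=> B ?; apply: sub_sigma_algebra; left; left. Qed.

Lemma sigma_of_xi1_sub k t : (1 <= t <= k.+1)%N -> sigma_of (xi1 t) `<=` F k.
Proof.
by move=> tk B Bt; apply: sub_sigma_algebra; left; right; exists t => //; left.
Qed.

Lemma sigma_of_xi2_sub k t : (1 <= t <= k.+1)%N -> sigma_of (xi2 t) `<=` F k.
Proof.
by move=> tk B Bt; apply: sub_sigma_algebra; left; right; exists t => //; right.
Qed.

Lemma sigma_of_omega_sub k i j : (1 <= j <= i)%N -> sigma_of (omega k j) `<=` I k i.
Proof. by move=> ji B Bt; apply: sub_sigma_algebra; right; exists j. Qed.

End filtrations.

(** * Contraction by the feasibility steps *)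

Section convergence.
Context {R : realType} {n : nat} {d dA dXi : measure_display}
  {T : measurableType d} (P : probability T R)
  {A : measurableType dA} {Xi : measurableType dXi}.
Variables (Y : set 'rV[R]_n) (g : A -> 'rV[R]_n -> R) (D Mg : R).
Local Notation S := (feasible_set g `&` Y).
Hypotheses (hgmeas : forall x, measurable_fun [set: A] (fun a => g a x))
  (hYclosed : closed Y)
  (hYconvex : convex_set (Y : set (convex_lmodType 'rV[R]_n)))
  (hS : S !=set0)
  (hgconvex : forall a, convex_function [set: convex_lmodType 'rV[R]_n]
     (g a : convex_lmodType 'rV[R]_n -> R^o))
  (hD : forall x y, Y x -> Y y -> eucl_norm (x - y) ^+ 2 <= D)
  (hMg0 : 0 < Mg)
  (hMg : forall a x s, Y x -> subdiff (g a) x s -> eucl_norm s <= Mg).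

Let diam : R := Num.sqrt D.

Let diam_ge0 : 0 <= diam. Proof. exact: sqrtr_ge0. Qed.

Let Y0 : Y !=set0. Proof. by case: hS => y [_ Yy]; exists y. Qed.

Let norm_le_diam x y : Y x -> Y y -> eucl_norm (x - y) <= diam.
Proof.
move=> Yx Yy; rewrite -[leLHS]ger0_norm ?eucl_norm_ge0// -sqrtr_sqr.
by apply: ler_wsqrtr; exact: hD.
Qed.

Lemma feasible_compact : compact Y.
Proof.
apply: bounded_closed_compact => //; have [y0 Yy0] := Y0.
exists (`|y0| + diam); split; first exact: num_real.
move=> M My x Yx /=; apply: ltW; apply: le_lt_trans My.
rewrite -[x in leLHS](subrK y0) (le_trans (ler_normD _ _))// addrC lerD2l.
by rewrite (le_trans (mx_norm_le_eucl_norm _))// norm_le_diam.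
Qed.

Let cY := feasible_compact.

Lemma feasible_dist_bounds y : Y y -> 0 <= eucl_dist y S <= diam.
Proof.
move=> Yy; rewrite eucl_dist_ge0//=; have [s Ss] := hS.
by rewrite (le_trans (eucl_dist_le y Ss))// norm_le_diam//; case: Ss.
Qed.

Lemma pospart_lipschitz a x y : Y x ->
  pospart (g a) x <= pospart (g a) y + Mg * eucl_norm (x - y).
Proof. by apply: convex_pospart_lipschitz => // u s; exact: hMg. Qed.

(** Compare with a point of [S], where every positive part vanishes and which is at distance at most
    [diam]. *)
Lemma pospart_bounds a y : Y y -> 0 <= pospart (g a) y <= Mg * diam.
Proof.
move=> Yy; rewrite pospart_ge0/=; have [s [Xs Ys]] := hS.
rewrite (le_trans (pospart_lipschitz a s Yy))// pospart_eq0 ?add0r; last exact: Xs.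
by rewrite ler_pM2l// norm_le_diam.
Qed.

Lemma measurable_pospart y : measurable_fun setT (fun a => pospart (g a) y).
Proof. by apply: measurable_maxr. Qed.

Variables (x0 : T -> 'rV[R]_n) (xi1 xi2 : nat -> T -> Xi)
  (omega : nat -> nat -> T -> A) (N : nat -> nat).
Hypotheses (hxi1 : forall k, measurable_fun [set: T] (xi1 k))
  (hxi2 : forall k, measurable_fun [set: T] (xi2 k))
  (homega : forall k i, measurable_fun [set: T] (omega k i))
  (hx0meas : measurable_fun [set: T] (x0 : T -> borel_rV R n)).
Local Notation F := (filtration x0 xi1 xi2 omega N).
Local Notation I := (inner_filtration x0 xi1 xi2 omega N).

Let FM k : F k `<=` measurable. Proof. exact: filtration_measurable. Qed.

Let IM k i : I k i `<=` measurable. Proof. exact: inner_filtration_measurable. Qed.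

Let mpos k i y : measurable_fun setT (fun w => pospart (g (omega k i w)) y).
Proof. exact: (measurableT_comp (measurable_pospart y)). Qed.

Variable c : R.
Hypotheses (hc : 0 < c) (hA5 : growth_condition x0 xi1 xi2 omega N P Y g c).

(** Both readings of (A5) meet here: under independence the integral over [B] is [P B] times the
    expectation, and otherwise the defining property of the conditional expectation applies to
    [B]. *)
Lemma growth_condition_integral k i y B :
  (1 <= k)%N -> (1 <= i <= N k)%N -> Y y -> I k i.-1 B ->
  (\int[P]_(w in B) (eucl_dist y S ^+ 2)%:E <=
   \int[P]_(w in B) (c * pospart (g (omega k i w)) y ^+ 2)%:E)%E.
Proof.
move=> k1 iN Yy IB; have mB := IM IB.
have mp2 : measurable_fun setT (fun w => pospart (g (omega k i w)) y ^+ 2).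
  exact: measurable_funX.
have -> : (\int[P]_(w in B) (c * pospart (g (omega k i w)) y ^+ 2)%:E =
    c%:E * \int[P]_(w in B) (pospart (g (omega k i w)) y ^+ 2)%:E)%E.
  under eq_integral do rewrite -[c * _]addr0.
  rewrite ge0_integral_affine ?mul0e ?adde0// ?ltW// => w; exact: sqr_ge0.
case: hA5 => [[[indep _] growth]|growth].
  have -> : (\int[P]_(w in B) (pospart (g (omega k i w)) y ^+ 2)%:E =
      P B * 'E_P[(fun w => pospart (g (omega k i w)) y ^+ 2)%R])%E.
    rewrite unlock.
    apply: (ge0_integral_independent
      (h := fun a => (pospart (g a) y ^+ 2)%:E) mB IB _ (indep _ _ k1 iN)) => //.
      by apply/measurable_EFinP/measurable_funX; exact: measurable_pospart.
    by move=> a; rewrite lee_fin sqr_ge0.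
  by rewrite integral_cst// muleCA muleC lee_wpmul2l// growth.
have ip2 : P.-integrable setT (EFin \o (fun w => pospart (g (omega k i w)) y ^+ 2)).
  apply: (@bounded_integrable _ _ _ _ _ ((Mg * diam) ^+ 2)) => // w.
  have /andP[p0 pM] := pospart_bounds (omega k i w) Yy.
  by rewrite sqr_ge0/= lerXn2r// nnegrE// (le_trans p0).
have [] := cond_expP (@IM k i.-1) ip2.
set Z := cond_exp _ _ _ => mZ iZ ZE.
have mZT := measurable_wrt_measurable (@IM k i.-1) mZ.
rewrite -ZE; last by rewrite inner_filtration_sigma.
have cZ : {ae P, forall w, eucl_dist y S ^+ 2 <= c * Z w}.
  exact: growth.
rewrite -integralZl//; last exact: integrableS iZ.
(* [Z] is only a version of the conditional expectation and may be negative on a null set; the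
   maximum is a nonnegative integrand with the same integral. *)
apply: (@le_trans _ _ (\int[P]_(w in B) (Num.max (c * Z w) 0)%:E)%E).
  apply: ae_ge0_le_integral => //.
  - by move=> w _; rewrite lee_fin sqr_ge0.
  - by move=> w _; rewrite lee_fin le_max lexx orbT.
  - apply/measurable_EFinP/measurable_funTS/measurable_maxr => //.
    exact: measurable_funM.
  - apply: filterS cZ => w h _; rewrite lee_fin.
    by rewrite (le_trans h)// le_max lexx.
rewrite le_eqVlt; apply/orP; left; apply/eqP/ae_eq_integral => //.
- apply/measurable_EFinP/measurable_funTS/measurable_maxr => //.
  exact: measurable_funM.
- apply/(@measurable_EFinP _ _ _ _ (fun w => c * Z w))/measurable_funTS.
  exact: measurable_funM.
- by apply: filterS cZ => w h _; rewrite max_l// (le_trans _ h)// sqr_ge0.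
Qed.

(** * One run of the feasibility steps, at a fixed iteration [k] *)

Variables (k : nat) (beta : R) (d0 : 'rV[R]_n) (v : T -> 'rV[R]_n)
  (dd z : nat -> T -> 'rV[R]_n).
Hypotheses (hk : (1 <= k)%N) (hbeta0 : 0 < beta) (hbeta2 : beta < 2)
  (vmeas : measurable_wrt (F k.-1) (v : T -> borel_rV R n))
  (vY : forall w, Y (v w))
  (hdd : forall i, (1 <= i <= N k)%N ->
     measurable_wrt (I k i) (dd i : T -> borel_rV R n))
  (hz : forall w, feasibility_steps Y g beta d0 (N k) (v w)
     (fun i => omega k i w) (fun i => dd i w) (fun i => z i w)).

Lemma feasibility_iterate i w : (i <= N k)%N -> Y (z i w).
Proof.
have [z0 zS] := hz w; case: i => [_|i iN]; first by rewrite z0.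
have [_ _ ->] := zS i.+1 iN.
by have [] := eucl_projP Y0 cY (z i w - (beta *
  (pospart (g (omega k i.+1 w)) (z i w) / eucl_norm (dd i.+1 w) ^+ 2)) *: dd i.+1 w).
Qed.

Lemma measurable_feasibility_iterate i : (i <= N k)%N ->
  measurable_wrt (I k i) (z i : T -> borel_rV R n).
Proof.
elim: i => [_|i IH iN].
  have -> : z 0%N = v by apply/funext => w; have [] := hz w.
  apply: measurable_wrtW vmeas => B FB; apply: sub_sigma_algebra.
  exact: sub_inner_filtration.
have zE : z i.+1 = fun w => eucl_proj Y (z i w - (beta *
    (pospart (g (omega k i.+1 w)) (z i w) / eucl_norm (dd i.+1 w) ^+ 2)) *: dd i.+1 w).
  by apply/funext => w; have [_ /(_ i.+1 iN)[]] := hz w.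
have mz : measurable_wrt (I k i.+1) (z i : T -> borel_rV R n).
  apply: measurable_wrtW (IH (ltnW iN)) => B FB; apply: sub_sigma_algebra.
  exact: sub_inner_filtrationS FB.
have mo : measurable_wrt (I k i.+1) (omega k i.+1).
  apply: measurable_wrt_sigma_of => B FB; apply: sub_sigma_algebra.
  by apply: sigma_of_omega_sub FB; rewrite ltnS leqnn.
rewrite zE; apply: (measurable_feasibility_step Y0 cY hYconvex) => //; last exact: hdd.
(* Taking [I k i.+1] as the sigma-algebra on [T] yields measurability with respect to the past, not
   just measurability. *)
apply: (@measurable_lipschitz_parameter _ _ _ (g_sigma_algebraType (I k i.+1))
  (fun w => pospart (g (omega k i.+1 w))) Y Mg) => //.
- by move=> y Yy; exact: (measurableT_comp (measurable_pospart y)).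
- by move=> w x y Yx Yy; exact: pospart_lipschitz.
- by move=> w; apply: feasibility_iterate; exact: ltnW.
Qed.

Let zM i : (i <= N k)%N -> measurable_fun setT (z i : T -> borel_rV R n).
Proof.
by move=> iN; exact: measurable_wrt_measurable (@IM k i) (measurable_feasibility_iterate iN).
Qed.

Lemma measurable_feasible_dist (f : T -> borel_rV R n) :
  measurable_fun setT f -> measurable_fun setT (fun w => eucl_dist (f w : 'rV[R]_n) S).
Proof.
apply: (@measurableT_comp _ _ _ _ _ _
  (fun y : borel_rV R n => eucl_dist (y : 'rV[R]_n) S)).
by apply: continuous_borel_measurable; exact: eucl_dist_continuous.
Qed.

Let kappa := beta * (2 - beta) / Mg ^+ 2.

Let kappa_ge0 : 0 <= kappa.
Proof. by rewrite divr_ge0 ?sqr_ge0// mulr_ge0 ?subr_ge0 ?ltW. Qed.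

Lemma feasible_dist_descent i w : (i.+1 <= N k)%N ->
  eucl_dist (z i.+1 w) S ^+ 2 + kappa * pospart (g (omega k i.+1 w)) (z i w) ^+ 2 <=
  eucl_dist (z i w) S ^+ 2.
Proof.
move=> iN; set p := pospart _ _; set a := eucl_dist (z i.+1 w) S.
have t0 : 0 <= a ^+ 2 + kappa * p ^+ 2 by rewrite addr_ge0 ?sqr_ge0// mulr_ge0 ?sqr_ge0.
(* [eucl_dist] is an infimum of norms, not of squares, so the left side is turned into the square of
   its root before it is compared with each [y] in [S]. *)
rewrite -(sqr_sqrtr t0) lerXn2r ?nnegrE ?sqrtr_ge0 ?eucl_dist_ge0//.
apply: le_eucl_dist => // y [Xy Yy].
rewrite -ler_sqr ?nnegrE ?eucl_norm_ge0 ?sqrtr_ge0// sqr_sqrtr// -lerBrDr.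
have [_ /(_ i.+1 iN)[sP _ zE]] := hz w.
apply: (@le_trans _ _ (eucl_norm (z i.+1 w - y) ^+ 2)).
  by rewrite lerXn2r ?nnegrE ?eucl_norm_ge0 ?eucl_dist_ge0// eucl_dist_le.
rewrite zE; apply: feasibility_step_descent => //; last exact: Xy.
- by move=> x s; exact: hMg.
- by apply: feasibility_iterate; exact: ltnW.
Qed.

Variable q : R.
Hypotheses (hq : q = beta * (2 - beta) / (c * Mg ^+ 2)) (hq0 : 0 < q) (hq1 : q < 1).

Lemma feasible_dist_contraction_step i B : (i.+1 <= N k)%N -> I k i B ->
  (\int[P]_(w in B) (eucl_dist (z i.+1 w) S ^+ 2)%:E <=
   (1 - q)%:E * \int[P]_(w in B) (eucl_dist (z i w) S ^+ 2)%:E)%E.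
Proof.
move=> iN IB; have mB := IM IB; have iN' := ltnW iN.
(* This is the origin of [q]: the descent subtracts [kappa * p ^+ 2 = q * (c * p ^+ 2)], and the
   integral of [c * p ^+ 2] dominates that of the squared distance. *)
have qc : kappa = q * c by rewrite /kappa hq; field; rewrite !gt_eqF.
pose p w := pospart (g (omega k i.+1 w)) (z i w).
have mp : measurable_fun setT p.
  apply: (@measurable_lipschitz_parameter _ _ _ T
    (fun w => pospart (g (omega k i.+1 w))) Y Mg) => //.
  - by move=> w x y Yx Yy; exact: pospart_lipschitz.
  - exact: zM.
  - by move=> w; exact: feasibility_iterate.
have md j : (j <= N k)%N -> measurable_fun setT (fun w => eucl_dist (z j w) S ^+ 2).
  by move=> jN; apply/measurable_funX/measurable_feasible_dist/zM.
have growth : (\int[P]_(w in B) (eucl_dist (z i w) S ^+ 2)%:E <=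
    \int[P]_(w in B) (c * p w ^+ 2)%:E)%E.
  (* One constant for both functions: the first summand is a Lipschitz constant of the squared
     distance on [Y], the second one of [c] times the squared positive part. *)
  pose L := 2 * diam + 2 * c * (Mg * diam) * Mg.
  have L0 : 0 <= L by rewrite addr_ge0 ?mulr_ge0// ltW.
  apply: (@integral_frozen_parameter _ _ _ P n (I k i) Y (fun y => eucl_dist y S ^+ 2)
    (fun w y => c * pospart (g (omega k i.+1 w)) y ^+ 2) L (z i)) => //.
  - by move=> y _; exact: sqr_ge0.
  - by move=> w y _; rewrite mulr_ge0 ?sqr_ge0// ltW.
  - move=> x y Yx Yy; apply: le_trans (ler_sqr_lipschitz
      (feasible_dist_bounds Yx) (feasible_dist_bounds Yy)
      (eucl_dist_lipschitz x y hS) (eucl_norm_ge0 _)) _.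
    by rewrite lerD2l ler_wpM2r ?eucl_norm_ge0// lerDl !mulr_ge0// ltW.
  - move=> w x y Yx Yy.
    have h : 0 <= Mg * eucl_norm (x - y) by rewrite mulr_ge0 ?eucl_norm_ge0// ltW.
    have := ler_sqr_lipschitz (pospart_bounds (omega k i.+1 w) Yx)
      (pospart_bounds (omega k i.+1 w) Yy) (pospart_lipschitz _ y Yx) h.
    rewrite -(ler_pM2l hc) => /le_trans; apply.
    have -> : L * eucl_norm (x - y) = 2 * diam * eucl_norm (x - y) +
        c * (2 * (Mg * diam) * (Mg * eucl_norm (x - y))) by rewrite /L; ring.
    by rewrite mulrDr lerD2l lerDr !mulr_ge0 ?eucl_norm_ge0.
  - move=> y Yy; apply: measurable_funM => //; exact: measurable_funX.
  - exact: measurable_feasibility_iterate.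
  - by move=> w; exact: feasibility_iterate.
  - move=> y C Yy; rewrite inner_filtration_sigma => IC.
    exact: (@growth_condition_integral k i.+1).
  - by rewrite inner_filtration_sigma.
(* Finiteness allows [q] times the current integral to be moved across the inequality at the end. *)
have id j : (j <= N k)%N -> (\int[P]_(w in B) (eucl_dist (z j w) S ^+ 2)%:E)%E \is a fin_num.
  move=> jN; apply: integrable_fin_num => //; apply: (integrableS measurableT) => //.
  apply: (@bounded_integrable _ _ _ _ _ (diam ^+ 2)) => // [|w]; first exact: md.
  have /andP[? ?] := feasible_dist_bounds (feasibility_iterate w jN).
  by rewrite sqr_ge0/= lerXn2r// nnegrE.
have mcp : measurable_fun setT (fun w => c * p w ^+ 2).
  by apply: measurable_funM => //; exact: measurable_funX.
have cp0 w : 0 <= c * p w ^+ 2 by rewrite mulr_ge0 ?sqr_ge0// ltW.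
have : (\int[P]_(w in B) (eucl_dist (z i.+1 w) S ^+ 2)%:E +
    q%:E * \int[P]_(w in B) (eucl_dist (z i w) S ^+ 2)%:E <=
    \int[P]_(w in B) (eucl_dist (z i w) S ^+ 2)%:E)%E.
  apply: (@le_trans _ _ (\int[P]_(w in B)
      (eucl_dist (z i.+1 w) S ^+ 2 + q * (c * p w ^+ 2))%:E)%E).
    under [leRHS]eq_integral do rewrite EFinD (EFinM q).
    rewrite ge0_integralD//.
    - rewrite leeD2l// ge0_integralZl_EFin//.
      + by rewrite lee_wpmul2l// lee_fin ltW.
      + by move=> w _; rewrite lee_fin.
      + by apply/measurable_EFinP/measurable_funTS.
      + exact: ltW.
    - by move=> w _; rewrite lee_fin sqr_ge0.
    - by apply/measurable_EFinP/measurable_funTS; exact: md.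
    - by move=> w _; rewrite -EFinM lee_fin mulr_ge0// ltW.
    - by apply/measurable_EFinP/measurable_funTS/measurable_funM.
  apply: ge0_le_integral => //.
  - by move=> w _; rewrite lee_fin addr_ge0 ?sqr_ge0// mulr_ge0// ltW.
  - apply/measurable_EFinP/measurable_funTS/measurable_funD; first exact: md.
    exact: measurable_funM.
  - by apply/measurable_EFinP/measurable_funTS; exact: md.
  - by move=> w _; rewrite lee_fin mulrA -qc feasible_dist_descent.
have := id _ iN; have := id _ iN'.
case: (\int[P]_(w in B) _)%E => // a _; case: (\int[P]_(w in B) _)%E => // b _.
by rewrite -EFinM -EFinM -EFinD !lee_fin; lra.
Qed.

(** An event of [F k.-1] lies in every [I k i], so the one-step bound can be iterated on the same
    [B]. *)
Lemma feasible_dist_contraction B : F k.-1 B ->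
  (\int[P]_(w in B) (eucl_dist (z (N k) w) S ^+ 2)%:E <=
   ((1 - q) ^+ N k)%:E * \int[P]_(w in B) (eucl_dist (v w) S ^+ 2)%:E)%E.
Proof.
move=> FB; suff /(_ _ (leqnn _)) : forall i, (i <= N k)%N ->
    (\int[P]_(w in B) (eucl_dist (z i w) S ^+ 2)%:E <=
    ((1 - q) ^+ i)%:E * \int[P]_(w in B) (eucl_dist (v w) S ^+ 2)%:E)%E by [].
elim=> [_|i IH iN].
  by rewrite expr0 mul1e (_ : z 0%N = v)//; apply/funext => w; have [] := hz w.
have IB : I k i B by exact: sub_inner_filtration.
apply: (le_trans (feasible_dist_contraction_step iN IB)).
rewrite exprS EFinM -muleA lee_wpmul2l//; first by rewrite lee_fin subr_ge0 ltW.
exact/IH/ltnW.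
Qed.

(** * From integrals over past events to conditional expectations *)

Let zN w : Y (z (N k) w). Proof. exact: feasibility_iterate. Qed.

Let measurable_dist : measurable_fun setT (fun w => eucl_dist (z (N k) w) S).
Proof. exact/measurable_feasible_dist/zM. Qed.

Let integrable_dist : P.-integrable setT (EFin \o (fun w => eucl_dist (z (N k) w) S)).
Proof.
by apply: bounded_integrable => // w; exact: (feasible_dist_bounds (zN w)).
Qed.

Let integrable_sqr_dist :
  P.-integrable setT (EFin \o (fun w => eucl_dist (z (N k) w) S ^+ 2)).
Proof.
apply: (@bounded_integrable _ _ _ _ _ (diam ^+ 2)) => [|w].
  exact: measurable_funX.
have /andP[? ?] := feasible_dist_bounds (zN w).
by rewrite sqr_ge0/= lerXn2r// nnegrE.
Qed.

Let measurable_start_dist :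
  measurable_fun [set: g_sigma_algebraType (F k.-1)] (fun w => eucl_dist (v w) S).
Proof.
apply: (@measurableT_comp _ _ _ _ _ _
  (fun y : borel_rV R n => eucl_dist (y : 'rV[R]_n) S)) vmeas.
by apply: continuous_borel_measurable; exact: eucl_dist_continuous.
Qed.

Let measurable_start_distT : measurable_fun setT (fun w => eucl_dist (v w) S).
Proof. exact: measurable_wrt_measurable (@FM k.-1) measurable_start_dist. Qed.

Let q1 : 0 <= 1 - q. Proof. by rewrite subr_ge0 ltW. Qed.

Let start_dist_le w : 0 <= (1 - q) ^+ N k * eucl_dist (v w) S ^+ 2 <= diam ^+ 2.
Proof.
have /andP[v0 vd] := feasible_dist_bounds (vY w).
rewrite mulr_ge0 ?exprn_ge0 ?sqr_ge0//= -[leRHS]mul1r ler_pM ?exprn_ge0//.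
  by rewrite exprn_ile1// gerBl ltW.
by rewrite lerXn2r// nnegrE.
Qed.

Lemma cond_exp_sqr_feasible_dist :
  {ae P, forall w, forall y, S y ->
    cond_exp P (F k.-1) (fun w' => eucl_dist (z (N k) w') S ^+ 2) w
    <= (1 - q) ^+ N k * eucl_norm (v w - y) ^+ 2}.
Proof.
have mU : measurable_fun [set: g_sigma_algebraType (F k.-1)]
    (fun w => (1 - q) ^+ N k * eucl_dist (v w) S ^+ 2).
  by apply: measurable_funM => //; exact: measurable_funX.
have iU : P.-integrable setT
    (EFin \o (fun w => (1 - q) ^+ N k * eucl_dist (v w) S ^+ 2)).
  by apply: bounded_integrable start_dist_le; exact: measurable_wrt_measurable (@FM k.-1) mU.
have := cond_exp_le (@FM k.-1) (cond_expP (@FM k.-1) integrable_sqr_dist) mU iU.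
have le_int B : <<s F k.-1 >> B ->
    (\int[P]_(w in B) (eucl_dist (z (N k) w) S ^+ 2)%:E <=
     \int[P]_(w in B) ((1 - q) ^+ N k * eucl_dist (v w) S ^+ 2)%:E)%E.
  rewrite filtration_sigma => FB; rewrite (le_trans (feasible_dist_contraction FB))//.
  under [leRHS]eq_integral do rewrite -[_ * _]addr0.
  rewrite ge0_integral_affine ?mul0e ?adde0 ?exprn_ge0//.
  - exact: FM FB.
  - exact: measurable_funX.
  - by move=> w; exact: sqr_ge0.
move=> /(_ le_int); apply: filterS => w h y Sy; apply: (le_trans h).
rewrite ler_wpM2l ?exprn_ge0// lerXn2r ?nnegrE ?eucl_norm_ge0 ?eucl_dist_ge0//.
exact: eucl_dist_le.
Qed.

(* Conditional Jensen by hand: [r <= (r^2 / t + t) / 2] for every rational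
   [t > 0], and the infimum over [t] of the conditional bound is its root. *)
Lemma cond_exp_feasible_dist :
  {ae P, forall w, forall y, S y ->
    cond_exp P (F k.-1) (fun w' => eucl_dist (z (N k) w') S) w
    <= (1 - q) `^ ((N k)%:R / 2) * eucl_norm (v w - y)}.
Proof.
pose V w := (1 - q) `^ ((N k)%:R / 2) * eucl_dist (v w) S.
have V0 w : 0 <= V w by rewrite mulr_ge0 ?powR_ge0 ?eucl_dist_ge0.
have V2 w : V w ^+ 2 = (1 - q) ^+ N k * eucl_dist (v w) S ^+ 2.
  rewrite exprMn; congr (_ * _); rewrite expr2 -powRD; last first.
    by apply/implyP => _; rewrite gt_eqF// subr_gt0.
  by rewrite -splitr powR_mulrn.
set Z := cond_exp _ _ _.
(* Rational parameters keep the exceptional null sets countable in number. *)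
have bound (r : rat) : {ae P, forall w, 0 < (ratr r : R) ->
    Z w <= V w ^+ 2 / ratr r / 2 + ratr r / 2}.
  have [r0|r0] := leP (ratr r : R) 0.
    exact: aeW.
  set t : R := ratr r in r0 *.
  have t2 : 0 <= t / 2 by rewrite divr_ge0// ltW.
  have it2 : 0 <= (2 * t)^-1 by rewrite invr_ge0 mulr_ge0// ltW.
  pose U w := (2 * t)^-1 * V w ^+ 2 + t / 2.
  have mU : measurable_fun [set: g_sigma_algebraType (F k.-1)] U.
    apply: measurable_funD => //; apply: measurable_funM => //.
    by apply: measurable_funX; exact: measurable_funM.
  have mUT := measurable_wrt_measurable (@FM k.-1) mU.
  have iU : P.-integrable setT (EFin \o U).
    apply: (@bounded_integrable _ _ _ _ _ ((2 * t)^-1 * diam ^+ 2 + t / 2)) => // w.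
    have /andP[h1 h2] := start_dist_le w.
    have U0 : 0 <= (2 * t)^-1 * V w ^+ 2 by rewrite V2 mulr_ge0.
    by rewrite /U addr_ge0//= lerD2r V2 ler_wpM2l.
  have := cond_exp_le (@FM k.-1) (cond_expP (@FM k.-1) integrable_dist) mU iU.
  have le_int B : <<s F k.-1 >> B ->
      (\int[P]_(w in B) (eucl_dist (z (N k) w) S)%:E <= \int[P]_(w in B) (U w)%:E)%E.
    rewrite filtration_sigma => FB; have mB := FM FB.
    have mz2 := measurable_funX 2 measurable_dist.
    apply: (@le_trans _ _ (\int[P]_(w in B)
        ((2 * t)^-1 * eucl_dist (z (N k) w) S ^+ 2 + t / 2)%:E)%E).
      apply: ge0_le_integral => //.
      - by move=> w _; rewrite lee_fin eucl_dist_ge0.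
      - by apply/measurable_EFinP/measurable_funTS.
      - apply/measurable_EFinP/measurable_funTS/measurable_funD => //.
        exact: measurable_funM.
      - move=> w _; rewrite lee_fin; set a := eucl_dist _ _.
        have -> : (2 * t)^-1 * a ^+ 2 + t / 2 = a + (2 * t)^-1 * (a - t) ^+ 2.
          by field; rewrite gt_eqF.
        by rewrite lerDl mulr_ge0// sqr_ge0.
    rewrite ge0_integral_affine//; last by move=> w; exact: sqr_ge0.
    rewrite /U; under [leRHS]eq_integral do rewrite V2 mulrA.
    rewrite ge0_integral_affine//.
    - rewrite leeD2r// EFinM -muleA lee_wpmul2l//; exact: feasible_dist_contraction.
    - exact: measurable_funX.
    - by move=> w; exact: sqr_ge0.
    - by rewrite mulr_ge0// exprn_ge0.
  move=> /(_ le_int); apply: filterS => w h _; apply: (le_trans h).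
  by rewrite le_eqVlt; apply/orP; left; apply/eqP; rewrite /U; field; rewrite gt_eqF.
apply: filterS (ae_forall_rat bound) => w h y Sy.
apply: (@le_trans _ _ (V w)); last first.
  by rewrite ler_wpM2l ?powR_ge0// eucl_dist_le.
(* At a rational [r] strictly between [V w] and [Z w] the bound is at most [r], since
   [V w ^+ 2 / r <= r]; this contradicts [r < Z w]. *)
rewrite leNgt; apply/negP => /rat_in_itvoo[r]; rewrite in_itv/= => /andP[Vr rZ].
have r0 : 0 < (ratr r : R) by exact: le_lt_trans Vr.
have := h r r0; rewrite leNgt => /negP; apply; apply: le_lt_trans rZ.
have : V w ^+ 2 / ratr r <= ratr r.
  by rewrite ler_pdivrMr// -expr2 lerXn2r ?nnegrE ?(ltW r0)// ltW.
lra.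
Qed.

End convergence.

Theorem lemma4p4 (R : realType) (n : nat)
  (* probability space, index set, oracle sample space *)
  (d dA dXi : measure_display) (T : measurableType d) (P : probability T R)
  (A : measurableType dA) (Xi : measurableType dXi)
  (* problem data *)
  (Y : set 'rV[R]_n) (g : A -> 'rV[R]_n -> R)
  (hgmeas : forall x, measurable_fun [set: A] (fun a => g a x))
  (* (A1) *)
  (hYclosed : closed Y)
  (hYconvex : convex_set (Y : set (convex_lmodType 'rV[R]_n)))
  (hS : feasible_set g `&` Y !=set0)
  (hgconvex : forall a,
     convex_function [set: convex_lmodType 'rV[R]_n]
       (g a : convex_lmodType 'rV[R]_n -> R^o))
  (* (A2) *)
  (D : R) (hD : forall x y, Y x -> Y y -> eucl_norm (x - y) ^+ 2 <= D)
  (* bound on the subgradients *)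
  (Mg : R) (hMg0 : 0 < Mg)
  (hMg : forall a x s, Y x -> subdiff (g a) x s -> eucl_norm s <= Mg)
  (* parameters of the method *)
  (alpha : nat -> R) (halpha : forall k, 0 < alpha k)
  (N : nat -> nat) (hN : forall k, (1 <= k)%N -> (1 <= N k)%N)
  (beta : R) (hbeta0 : 0 < beta) (hbeta2 : beta < 2)
  (d0 : 'rV[R]_n) (hd0 : d0 != 0)
  (Fhat : 'rV[R]_n -> Xi -> 'rV[R]_n)
  (hFhat : measurable_fun (Y `*` [set: Xi] : set (borel_rV R n * Xi))
     (fun p : borel_rV R n * Xi => Fhat p.1 p.2 : borel_rV R n))
  (* random samples *)
  (xi1 xi2 : nat -> T -> Xi)
  (hxi1 : forall k, measurable_fun [set: T] (xi1 k))
  (hxi2 : forall k, measurable_fun [set: T] (xi2 k))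
  (omega : nat -> nat -> T -> A)
  (homega : forall k i, measurable_fun [set: T] (omega k i))
  (* iterates *)
  (x u v : nat -> T -> 'rV[R]_n)
  (hx0meas : measurable_fun [set: T] (x 0%N : T -> borel_rV R n))
  (hx0Y : forall w, Y (x 0%N w))
  (hu : forall k w, (1 <= k)%N ->
     u k w = eucl_proj Y (x k.-1 w - alpha k.-1 *: Fhat (x k.-1 w) (xi1 k w)))
  (hv : forall k w, (1 <= k)%N ->
     v k w = eucl_proj Y (x k.-1 w - alpha k.-1 *: Fhat (u k w) (xi2 k w)))
  (dd z : nat -> nat -> T -> 'rV[R]_n)
  (hddmeas : forall k i, (1 <= k)%N -> (1 <= i <= N k)%N ->
     measurable_wrt (inner_filtration (x 0%N) xi1 xi2 omega N k i)
       (dd k i : T -> borel_rV R n))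
  (hz : forall k w, (1 <= k)%N ->
     feasibility_steps Y g beta d0 (N k) (v k w)
       (fun i => omega k i w) (fun i => dd k i w) (fun i => z k i w))
  (hx : forall k w, (1 <= k)%N -> x k w = z k (N k) w)
  (* (A5) *)
  (c : R) (hc : 0 < c)
  (hA5 : growth_condition (x 0%N) xi1 xi2 omega N P Y g c)
  (q : R) (hq : q = beta * (2 - beta) / (c * Mg ^+ 2))
  (hq0 : 0 < q) (hq1 : q < 1) :
  forall k, (1 <= k)%N ->
    {ae P, forall w, forall y, (feasible_set g `&` Y) y ->
       cond_exp P (filtration (x 0%N) xi1 xi2 omega N k.-1)
         (fun w' => eucl_dist (x k w') (feasible_set g `&` Y) ^+ 2) w
       <= (1 - q) ^+ N k * eucl_norm (v k w - y) ^+ 2}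
    /\
    {ae P, forall w, forall y, (feasible_set g `&` Y) y ->
       cond_exp P (filtration (x 0%N) xi1 xi2 omega N k.-1)
         (fun w' => eucl_dist (x k w') (feasible_set g `&` Y)) w
       <= (1 - q) `^ ((N k)%:R / 2) * eucl_norm (v k w - y)}.
Proof.
have Y0 : Y !=set0 by case: hS => y [_ Yy]; exists y.
have cY : compact Y by exact: feasible_compact hYclosed hS hD.
have FM := @filtration_measurable _ _ _ _ _ _ _ _ _ _ _ omega N _ hx0meas hxi1 hxi2 homega.
set F := filtration _ _ _ _ _ in FM *.
have projY p : Y (eucl_proj Y p) by have [] := eucl_projP Y0 cY p.
(* [F k.-1] already contains both oracle samples of iteration [k], so the two projected steps stay
   measurable with respect to it. *)
have meas_v k : (1 <= k)%N -> (forall w, Y (x k.-1 w)) ->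
    measurable_wrt (F k.-1) (x k.-1 : T -> borel_rV R n) ->
    measurable_wrt (F k.-1) (v k : T -> borel_rV R n).
  move=> k1 Yx mx.
  have mu : measurable_wrt (F k.-1) (u k : T -> borel_rV R n).
    have -> : u k = fun w => eucl_proj Y (x k.-1 w - alpha k.-1 *: Fhat (x k.-1 w) (xi1 k w)).
      by apply/funext => w; exact: hu.
    apply: (@measurable_extragradient_step _ _ _ _ (g_sigma_algebraType (F k.-1)) _ Y) => //.
    apply: measurable_wrt_sigma_of => B FB; apply: sub_sigma_algebra.
    by apply: sigma_of_xi1_sub FB; rewrite k1 prednK/=.
  have -> : v k = fun w => eucl_proj Y (x k.-1 w - alpha k.-1 *: Fhat (u k w) (xi2 k w)).
    by apply/funext => w; exact: hv.
  apply: (@measurable_extragradient_step _ _ _ _ (g_sigma_algebraType (F k.-1)) _ Y) => //.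
    by move=> w; rewrite hu.
  apply: measurable_wrt_sigma_of => B FB; apply: sub_sigma_algebra.
  by apply: sigma_of_xi2_sub FB; rewrite k1 prednK/=.
have vY k w : (1 <= k)%N -> Y (v k w) by move=> k1; rewrite hv.
(* The induction alternates: [x k.-1] gives [v k], and the run started at [v k] gives [x k], because
   the inner filtration after [N k] draws lies in [F k]. *)
have meas_x k : (forall w, Y (x k w)) /\
    measurable_wrt (F k) (x k : T -> borel_rV R n).
  elim: k => [|k [Yx mx]].
    split=> //; apply: measurable_wrt_sigma_of => B FB; apply: sub_sigma_algebra.
    exact: sigma_of_x0_sub FB.
  have -> : x k.+1 = z k.+1 (N k.+1) by apply/funext => w; exact: hx.
  split => [w|].
    exact: (feasibility_iterate hYclosed hS hD (fun w => vY k.+1 w isT)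
      (fun w => hz k.+1 w isT) w (leqnn _)).
  apply: (@measurable_wrtW _ _ (inner_filtration (x 0%N) xi1 xi2 omega N k.+1 (N k.+1))).
    by move=> B IB; apply: sub_sigma_algebra; exact: inner_filtration_sub IB.
  apply: (measurable_feasibility_iterate hgmeas hYclosed hYconvex hS hgconvex hD hMg
    (meas_v k.+1 isT Yx mx) (fun w => vY k.+1 w isT)
    (fun i => hddmeas k.+1 i isT) (fun w => hz k.+1 w isT)) => //.
move=> k k1; have [Yx mx] := meas_x k.-1; have mv := meas_v k k1 Yx mx.
have xE : x k = z k (N k) by apply/funext => w; exact: hx.
rewrite xE; split.
- exact: (cond_exp_sqr_feasible_dist hgmeas hYclosed hYconvex hS hgconvex hD hMg0 hMg
    hxi1 hxi2 homega hx0meas hc hA5 k1 hbeta0 hbeta2 mv (fun w => vY k w k1)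
    (fun i => hddmeas k i k1) (fun w => hz k w k1) hq hq0 hq1).
- exact: (cond_exp_feasible_dist hgmeas hYclosed hYconvex hS hgconvex hD hMg0 hMg
    hxi1 hxi2 homega hx0meas hc hA5 k1 hbeta0 hbeta2 mv (fun w => vY k w k1)
    (fun i => hddmeas k i k1) (fun w => hz k w k1) hq hq0 hq1).
Qed.
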